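(* Let $\mathcal N$ be a finite and locally irreducible abelian network with total alphabet $A$, total kernel $K$ and production matrix $P$. Then: (i) the set $\overline{\mathrm{Rec}}(\mathcal N)^\times$ of invertible recurrent components is nonempty; (ii) $\mathrm{Tor}(\mathcal N)$ is a finite abelian group that acts freely on $\overline{\mathrm{Rec}}(\mathcal N)^\times$; (iii) the map $\phi:\mathbb N^A\to\mathrm{End}(\overline{\mathrm{Rec}}(\mathcal N))$, $\phi(\mathbf n)(\overline{\mathbf x.\mathbf q})=\overline{(\mathbf x+\mathbf n).\mathbf q}$, induces an isomorphism of abelian groups $\mathscr K(\mathcal N)\simeq\mathbb Z^A/(I-P)K$.
   Context: Abelian networks. $\mathbb N=\{0,1,2,\dots\}$. Let $G=(V,E)$ be a finite directed graph (self-loops and multiple edges allowed). An abelian network $\mathcal N$ on $G$ assigns to each $v\in V$ a nonempty input alphabet $A_v$ and a nonempty state space $Q_v$ (the $A_v$ pairwise disjoint), maps $T_a:Q_v\to Q_v$ for $a\in A_v$, and, for each edge $e$ from $v$ to $u$, a message-passing function $T_e:Q_v\times A_v\to A_u^*$ (free monoid of words), such that for all $v$, $a,b\in A_v$, $q\in Q_v$: $T_aT_b=T_bT_a$, and for every edge $e$ out of $v$ the words $T_e(q,a)T_e(T_a(q),b)$ and $T_e(q,b)T_e(T_b(q),a)$ agree up to permuting letters. Put $A=\bigsqcup_v A_v$, $Q=\prod_v Q_v$; $\mathcal N$ is finite if $A$ and $Q$ are finite. For a word $w\in A^*$, $|w|\in\mathbb N^A$ counts the occurrences of each letter. For $a\in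 A_v$, $\mathbf q\in Q$: $t_a\mathbf q$ is $\mathbf q$ with $\mathbf q(v)$ replaced by $T_a(\mathbf q(v))$, and $\mathbf M_a(\mathbf q)=\sum_{e\text{ out of }v}|T_e(\mathbf q(v),a)|\in\mathbb N^A$. A configuration is a pair $\mathbf x.\mathbf q$ with $\mathbf x\in\mathbb Z^A$, $\mathbf q\in Q$; $\pi_a(\mathbf x.\mathbf q)=(\mathbf x+\mathbf M_a(\mathbf q)-|a|).t_a\mathbf q$. For $w=a_1\cdots a_\ell$: $t_w=t_{a_\ell}\cdots t_{a_1}$, $\mathbf M_w(\mathbf q)=\sum_i\mathbf M_{a_i}(t_{a_1\cdots a_{i-1}}\mathbf q)$, $\pi_w=\pi_{a_\ell}\cdots\pi_{a_1}$; these depend only on $|w|$, so $t_{\mathbf n},\mathbf M_{\mathbf n},\pi_{\mathbf n}$ are defined for $\mathbf n\in\mathbb N^A$. The word $w$ is legal for $\mathbf x.\mathbf q$ if, with $\mathbf x_i.\mathbf q_i=\pi_{a_1\cdots a_i}(\mathbf x.\mathbf q)$, $\mathbf x_{i-1}(a_i)\ge1$ for all $1\le i\le\ell$. Write $\mathbf x.\mathbf q\xrightarrow{w}\mathbf x'.\mathbf q'$ if $w$ is legal for $\mathbf x.\mathbf q$ and $\pi_w(\mathbf x.\mathbf q)=\mathbf x'.\mathbf q'$; write $\mathbf x.\mathbf q\to\mathbf x'.\mathbf q'$ if this holds for some (possibly empty) $w$. Local recurrence, kernel, production matrix. $\mathcal N$ is locally irreducible if for all $\mathbf q,\mathbf q'\in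 Q$ there are words $w,w'$ with $t_w\mathbf q=t_{w'}\mathbf q'$. For $\mathcal N$ finite, let $e$ be the product of all idempotents of the finite commutative monoid generated by the $t_a$ in $\mathrm{End}(Q)$; $\mathrm{Loc}(\mathcal N)=eQ$ is the set of locally recurrent states. The total kernel is $K=\{\mathbf z\in\mathbb Z^A: t_{\mathbf z^+}\mathbf q=t_{\mathbf z^-}\mathbf q\ \forall\mathbf q\in\mathrm{Loc}(\mathcal N)\}$, with $\mathbf z^{\pm}\in\mathbb N^A$ the positive/negative parts of $\mathbf z$; it is a finite-index subgroup of $\mathbb Z^A$. For $\mathcal N$ finite and locally irreducible, the production matrix $P$ is the unique rational $A\times A$ matrix with $P\mathbf k=\mathbf M_{\mathbf k}(\mathbf q)$ for all $\mathbf k\in K\cap\mathbb N^A$ and $\mathbf q\in\mathrm{Loc}(\mathcal N)$ (it exists and does not depend on $\mathbf q$). Components. Two configurations are legally related if there is $\mathbf x_3.\mathbf q_3$ with $\mathbf x_1.\mathbf q_1\to\mathbf x_3.\mathbf q_3$ and $\mathbf x_2.\mathbf q_2\to\mathbf x_3.\mathbf q_3$ (an equivalence relation). A component of the trajectory digraph (the digraph on configurations with an $a$-labelled edge whenever $\mathbf x.\mathbf q\xrightarrow{a}\mathbf x'.\mathbf q'$) is an equivalence class of this relation; $\overline{\mathbf x.\mathbf q}$ is the component of $\mathbf x.\mathbf q$. An infinite walk is a sequence of configurations $\mathbf x_i.\mathbf q_i$ and letters $a_i$ with $\mathbf x_{i-1}.\mathbf q_{i-1}\xrightarrow{a_i}\mathbf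 x_i.\mathbf q_i$ for consecutive indices in $I$, where $I$ is $\mathbb Z_{\le0}$, $\mathbb Z_{\ge0}$ or $\mathbb Z$; it is diverse if each letter $a\in A$ equals $a_i$ for infinitely many $i$. A component is recurrent if it contains a diverse infinite walk. $\overline{\mathrm{Rec}}(\mathcal N)$ is the set of recurrent components. Shift monoid and torsion group. $\mathbb N^A$ acts on $\overline{\mathrm{Rec}}(\mathcal N)$ by $\phi(\mathbf n)(\overline{\mathbf x.\mathbf q})=\overline{(\mathbf x+\mathbf n).\mathbf q}$; the shift monoid is $\mathscr M(\mathcal N)=\phi(\mathbb N^A)$. $\mathscr K(\mathcal N)$ is the Grothendieck group of this commutative monoid (classes $\overline{(m,m')}$ of pairs, $(m_1,m_1')\sim(m_2,m_2')$ iff $mm_1m_2'=mm_1'm_2$ for some $m$), and $\mathrm{Tor}(\mathcal N)$ is the torsion subgroup of $\mathscr K(\mathcal N)$. A recurrent component $\overline{\mathbf x.\mathbf q}$ is invertible if for every $g\in\mathrm{Tor}(\mathcal N)$ there is a recurrent component $\overline{\mathbf x'.\mathbf q'}$ such that $\overline{(\mathbf x+\mathbf n).\mathbf q}=\overline{(\mathbf x'+\mathbf n').\mathbf q'}$ for all $\mathbf n,\mathbf n'\in\mathbb N^A$ with $g=\overline{(\phi(\mathbf n),\phi(\mathbf n'))}$; $\overline{\mathrm{Rec}}(\mathcal N)^\times$ is the set of invertible ones, and $\mathrm{Tor}(\mathcal N)$ acts on it by $g\cdot\overline{\mathbf x.\mathbf q}=\overline{\mathbf x'.\mathbf q'}$.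 An action is free if $mx=m'x$ for some $x$ implies $m=m'$. *)

(* Defs.v *)
From HB Require Import structures.
From mathcomp Require Import all_boot all_order all_algebra.
From mathcomp Require Import generic_quotient ssrAC.
From mathcomp Require Import zify.
From mathcomp Require Import boolp classical_sets functions cardinality.

Set Implicit Arguments.
Unset Strict Implicit.
Unset Printing Implicit Defensive.

Import Order.TTheory GRing.Theory Num.Theory.
Local Open Scope ring_scope.
Local Open Scope quotient_scope.

Section QuotientGroup.
Variables (V : zmodType) (H : zmodClosed V).

Definition zquot_rel : rel V := fun x y => x - y \in H.

Fact zquot_refl : reflexive zquot_rel.
Proof. by move=> x; rewrite /zquot_rel subrr rpred0. Qed.

Fact zquot_sym : symmetric zquot_rel.
Proof. by move=> x y; rewrite /zquot_rel -opprB rpredN. Qed.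

Fact zquot_trans : transitive zquot_rel.
Proof.
move=> y x z xy yz; rewrite /zquot_rel -(subrK y x) -addrA.
exact: rpredD.
Qed.

Canonical zquot_equiv := EquivRel zquot_rel zquot_refl zquot_sym zquot_trans.

Definition zquot := {eq_quot zquot_rel}.
HB.instance Definition _ := Choice.on zquot.
HB.instance Definition _ := EqQuotient.on zquot.

Definition zquot_pi (x : V) : zquot := \pi_zquot x.
Definition zquot_add (x y : zquot) : zquot := zquot_pi (repr x + repr y).
Definition zquot_opp (x : zquot) : zquot := zquot_pi (- repr x).

Fact zquotP x y : zquot_pi x = zquot_pi y <-> x - y \in H.
Proof. by split=> [/eqquotP //|xy]; apply/eqquotP. Qed.

Fact zquot_addE x y : zquot_add (zquot_pi x) (zquot_pi y) = zquot_pi (x + y).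
Proof.
apply/zquotP; rewrite opprD addrACA.
by apply: rpredD; apply/zquotP; rewrite /zquot_pi reprK.
Qed.

Fact zquot_oppE x : zquot_opp (zquot_pi x) = zquot_pi (- x).
Proof.
apply/zquotP; rewrite -opprD rpredN.
by apply/zquotP; rewrite /zquot_pi reprK.
Qed.

Fact zquot_ind (P : zquot -> Prop) :
  (forall x, P (zquot_pi x)) -> forall x, P x.
Proof. by move=> Pp x; rewrite -[x]reprK. Qed.

Fact zquot_addA : associative zquot_add.
Proof.
elim/zquot_ind=> x; elim/zquot_ind=> y; elim/zquot_ind=> z.
by rewrite !zquot_addE addrA.
Qed.

Fact zquot_addC : commutative zquot_add.
Proof.
by elim/zquot_ind=> x; elim/zquot_ind=> y; rewrite !zquot_addE addrC.
Qed.

Fact zquot_add0 : left_id (zquot_pi 0) zquot_add.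
Proof. by elim/zquot_ind=> x; rewrite zquot_addE add0r. Qed.

Fact zquot_addN : left_inverse (zquot_pi 0) zquot_opp zquot_add.
Proof. by elim/zquot_ind=> x; rewrite zquot_oppE zquot_addE addNr. Qed.

HB.instance Definition _ :=
  GRing.isZmodule.Build zquot zquot_addA zquot_addC zquot_add0 zquot_addN.

End QuotientGroup.

(* Commutative monoids are nmodTypes, hence written additively. *)
Section GrothendieckGroup.
Variable M : nmodType.

Definition groth_rel : rel (M * M) :=
  fun p q => `[< exists m, m + p.1 + q.2 = m + p.2 + q.1 >].

Fact groth_refl : reflexive groth_rel.
Proof. by move=> p; apply/asboolP; exists 0; rewrite !add0r addrC. Qed.

Fact groth_symW p q : groth_rel p q -> groth_rel q p.
Proof.
move=> /asboolP[m E]; apply/asboolP; exists m.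
by rewrite addrAC -E addrAC.
Qed.

Fact groth_sym : symmetric groth_rel.
Proof. by move=> p q; apply/idP/idP; apply: groth_symW. Qed.

Fact groth_trans : transitive groth_rel.
Proof.
move=> q p r /asboolP[m E] /asboolP[m' E'].
apply/asboolP; exists (m + m' + q.1 + q.2).
transitivity ((m + p.1 + q.2) + (m' + q.1 + r.2)).
  by rewrite [LHS](AC (5*1) ((1*5*4)*(2*3*6))) //.
rewrite E E'.
by rewrite [RHS](AC (5*1) ((1*5*3)*(2*4*6))) //.
Qed.

Canonical groth_equiv := EquivRel groth_rel groth_refl groth_sym groth_trans.

Definition groth := {eq_quot groth_rel}.
HB.instance Definition _ := Choice.on groth.
HB.instance Definition _ := EqQuotient.on groth.

Definition groth_pair (m m' : M) : groth := \pi_groth (m, m').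
Definition groth_add (x y : groth) : groth :=
  groth_pair ((repr x).1 + (repr y).1) ((repr x).2 + (repr y).2).
Definition groth_opp (x : groth) : groth := groth_pair (repr x).2 (repr x).1.

Fact groth_pairP m1 m1' m2 m2' :
  groth_pair m1 m1' = groth_pair m2 m2' <->
  exists m, m + m1 + m2' = m + m1' + m2.
Proof.
split=> [/eqquotP/asboolP //|E]; apply/eqquotP; exact/asboolP.
Qed.

Fact groth_ind (P : groth -> Prop) :
  (forall m m', P (groth_pair m m')) -> forall x, P x.
Proof. by move=> Pp x; rewrite -[x]reprK; case: (repr x). Qed.

Fact groth_addE m1 m1' m2 m2' :
  groth_add (groth_pair m1 m1') (groth_pair m2 m2')
  = groth_pair (m1 + m2) (m1' + m2').
Proof.
rewrite /groth_add; set x := groth_pair m1 m1'; set y := groth_pair m2 m2'.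
have [m E] : exists m, m + (repr x).1 + m1' = m + (repr x).2 + m1.
  apply/groth_pairP; rewrite -/x -[RHS]reprK /groth_pair.
  by rewrite -surjective_pairing.
have [m' E'] : exists m, m + (repr y).1 + m2' = m + (repr y).2 + m2.
  apply/groth_pairP; rewrite -/y -[RHS]reprK /groth_pair.
  by rewrite -surjective_pairing.
apply/groth_pairP; exists (m + m').
rewrite [LHS](AC (2*2*2) ((1*3*5)*(2*4*6))) /=.
rewrite [RHS](AC (2*2*2) ((1*3*5)*(2*4*6))) /=.
by rewrite E E'.
Qed.

Fact groth_oppE m m' : groth_opp (groth_pair m m') = groth_pair m' m.
Proof.
rewrite /groth_opp; set x := groth_pair m m'.
have [k E] : exists k, k + (repr x).1 + m' = k + (repr x).2 + m.
  apply/groth_pairP; rewrite -/x -[RHS]reprK /groth_pair.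
  by rewrite -surjective_pairing.
by apply/groth_pairP; exists k.
Qed.

Fact groth_addA : associative groth_add.
Proof.
elim/groth_ind=> a a'; elim/groth_ind=> b b'; elim/groth_ind=> c c'.
by rewrite !groth_addE !addrA.
Qed.

Fact groth_addC : commutative groth_add.
Proof.
elim/groth_ind=> a a'; elim/groth_ind=> b b'.
by rewrite !groth_addE addrC [b' + _]addrC.
Qed.

Fact groth_add0 : left_id (groth_pair 0 0) groth_add.
Proof. by elim/groth_ind=> a a'; rewrite groth_addE !add0r. Qed.

Fact groth_addN : left_inverse (groth_pair 0 0) groth_opp groth_add.
Proof.
elim/groth_ind=> a a'; rewrite groth_oppE groth_addE.
by apply/groth_pairP; exists 0; rewrite !add0r !addr0 addrC.
Qed.

HB.instance Definition _ :=
  GRing.isZmodule.Build groth groth_addA groth_addC groth_add0 groth_addN.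

End GrothendieckGroup.

Section Torsion.
Variable U : zmodType.

Definition is_torsion : {pred U} :=
  fun g => `[< exists2 k, (0 < k)%N & g *+ k = 0 >].

Fact torsion_closed : zmod_closed is_torsion.
Proof.
split=> [|x y /asboolP[k k0 xk] /asboolP[l l0 yl]].
  by apply/asboolP; exists 1%N; rewrite ?mul0rn.
apply/asboolP; exists (k * l)%N; first by rewrite muln_gt0 k0.
by rewrite mulrnBl mulrnA xk mul0rn mulnC mulrnA yl mul0rn subrr.
Qed.

HB.instance Definition _ :=
  GRing.isZmodClosed.Build U is_torsion torsion_closed.

Record torsion := Torsion { torsion_val :> U; _ : torsion_val \in is_torsion }.
HB.instance Definition _ := [isSub for torsion_val].
HB.instance Definition _ := [Choice of torsion by <:].
HB.instance Definition _ := [SubChoice_isSubZmodule of torsion by <:].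

End Torsion.

Definition is_action (G : zmodType) (X : Type) (act : G -> X -> X) : Prop :=
  (forall x, act 0 x = x) /\
  (forall g h x, act (g + h) x = act g (act h x)).

Definition free_action (G X : Type) (act : G -> X -> X) : Prop :=
  forall g h x, act g x = act h x -> g = h.

(* A is finite iff every A_v is, and Q is finite iff every Q_v is (all the Q_v
   being nonempty), so finiteness is built into the types.  The alphabets need
   not be disjoint as types: A is the sigma type letter below.  The graph has a
   vertex: otherwise A is empty and there is no recurrent component. *)
Record finite_abelian_network := FiniteAbelianNetwork {
  vertex : finType;
  edge : finType;
  src : edge -> vertex;
  tgt : edge -> vertex;
  alphabet : vertex -> finType;
  state : vertex -> finType;
  trans : forall v, alphabet v -> state v -> state v;
  msg : forall e, state (src e) -> alphabet (src e) -> seq (alphabet (tgt e));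
  vertex_gt0 : (0 < #|vertex|)%N;
  alphabet_gt0 : forall v, (0 < #|alphabet v|)%N;
  state_gt0 : forall v, (0 < #|state v|)%N;
  trans_comm : forall v (a b : alphabet v) q,
    trans a (trans b q) = trans b (trans a q);
  msg_comm : forall e (a b : alphabet (src e)) q,
    perm_eq (msg q a ++ msg (trans a q) b) (msg q b ++ msg (trans b q) a)
}.

Section Network.
Variable N : finite_abelian_network.

Definition letter : finType := {v : vertex N & alphabet v}.
Definition to_letter v (a : alphabet v) : letter := existT _ v a.
Definition gstate : finType := {dffun forall v : vertex N, state v}.
Definition nvec : nmodType := {ffun letter -> nat}.
Definition zvec : zmodType := {ffun letter -> int}.

Definition occ (w : seq letter) : nvec := [ffun b => count_mem b w].
Definition toZ (n : nvec) : zvec := [ffun a => (n a)%:Z].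
Definition posv (z : zvec) : nvec := [ffun a => `|Num.max (z a) 0|%N].
Definition negv (z : zvec) : nvec := posv (- z).

(* tstep a, mstep a and pistep a are t_a, M_a and pi_a; the suffixes word and
   vec stand for the extensions to words and to N^A. *)
Definition tstep (a : letter) (q : gstate) : gstate :=
  [ffun v => dfwith q (trans (tagged a) (q (tag a))) v].

(* If src e = tag a, then exactly one c satisfies to_letter c == a,
   namely a itself; otherwise there is none. *)
Definition mstep (a : letter) (q : gstate) : nvec :=
  \sum_(e : edge N) \sum_(c : alphabet (src e) | to_letter c == a)
    occ [seq to_letter d | d <- msg (q (src e)) c].

Definition config : choiceType := (zvec * gstate)%type.

Definition pistep (a : letter) (c : config) : config :=
  (c.1 + toZ (mstep a c.2) - toZ (occ [:: a]), tstep a c.2).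

Definition tword (w : seq letter) (q : gstate) : gstate :=
  foldl (fun q a => tstep a q) q w.

Fixpoint mword (w : seq letter) (q : gstate) : nvec :=
  if w is a :: w' then mstep a q + mword w' (tstep a q) else 0.

Definition piword (w : seq letter) (c : config) : config :=
  foldl (fun c a => pistep a c) c w.

(* t_n and M_n are computed on one word w with |w| = n. *)
Definition word_of (n : nvec) : seq letter :=
  flatten [seq nseq (n a) a | a <- enum letter].

Definition tvec (n : nvec) (q : gstate) : gstate := tword (word_of n) q.
Definition mvec (n : nvec) (q : gstate) : nvec := mword (word_of n) q.

Definition legal_step (a : letter) (c c' : config) : Prop :=
  1 <= c.1 a /\ c' = pistep a c.

Fixpoint legal (w : seq letter) (c : config) : bool :=
  if w is a :: w' then (1 <= c.1 a) && legal w' (pistep a c) else true.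

Definition reaches (c c' : config) : Prop :=
  exists w, legal w c /\ piword w c = c'.

Definition locally_irreducible : Prop :=
  forall q q' : gstate, exists w w' : seq letter, tword w q = tword w' q'.

Lemma tstepC a b q : tstep a (tstep b q) = tstep b (tstep a q).
Proof.
case: a b => [u a] [w b]; apply/ffunP=> v; rewrite !ffunE /=.
have [E|NE] := eqVneq u w.
  case: _ / E b => b.
  have [E|NE] := eqVneq u v; last by rewrite !dfwith_out // !ffunE !dfwith_out.
  by case: _ / E; rewrite !dfwith_in trans_comm.
have NE' : w != u by rewrite eq_sym.
rewrite !(dfwith_out _ _ NE) !(dfwith_out _ _ NE').
have [E|NEu] := eqVneq u v.
  case: _ / E; rewrite dfwith_in dfwith_out // ffunE /= dfwith_in.
  by [].
rewrite dfwith_out // ffunE /=.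
have [E|NEw] := eqVneq w v.
  by case: _ / E; rewrite !dfwith_in.
by rewrite !dfwith_out // ffunE dfwith_out.
Qed.

Lemma mstep_ext (a : letter) (q q' : gstate) : q (tag a) = q' (tag a) -> mstep a q = mstep a q'.
Proof.
move=> E; apply: eq_bigr => e _; apply: eq_bigr => c /eqP ca.
by case: _ / ca E => /= ->.
Qed.

Lemma occ_cat w w' : occ (w ++ w') = occ w + occ w'.
Proof. by apply/ffunP=> b; rewrite !ffunE count_cat. Qed.

Lemma occ_perm w w' : perm_eq w w' -> occ w = occ w'.
Proof. by move=> /permP E; apply/ffunP=> b; rewrite !ffunE. Qed.

Lemma mstepC a b q :
  mstep a q + mstep b (tstep a q) = mstep b q + mstep a (tstep b q).
Proof.
have [E|NE] := eqVneq (tag a) (tag b); last first.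
  have Eb : mstep b (tstep a q) = mstep b q.
    by apply: mstep_ext; rewrite ffunE dfwith_out.
  have Ea : mstep a (tstep b q) = mstep a q.
    by apply: mstep_ext; rewrite ffunE dfwith_out // eq_sym.
  by rewrite Ea Eb addrC.
case: a b E => [v a] [w b] /= E; case: _ / E b => b.
rewrite -!big_split /=; apply: eq_bigr => e _.
have [E|NE] := eqVneq v (src e); last first.
  have K (x : alphabet v) (c : alphabet (src e)) :
      (to_letter c == to_letter x) = false.
    by apply/negP=> /eqP/(congr1 tag)/= E; rewrite E eqxx in NE.
  by rewrite !big_pred0 // => c; apply: K.
subst v.
have K (x c : alphabet (src e)) :
    (to_letter c == to_letter x) = (c == x).
  by rewrite eq_Tagged.
have S x (p : gstate) :
    \sum_(c | to_letter c == to_letter x)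
      occ [seq to_letter d | d <- msg (p (src e)) c]
    = occ [seq to_letter d | d <- msg (p (src e)) x].
  by under eq_bigl => c do rewrite K; rewrite big_pred1_eq.
rewrite !S -!occ_cat -!map_cat; apply: occ_perm; apply: perm_map.
by rewrite !ffunE !dfwith_in msg_comm.
Qed.

Lemma toZD m n : toZ (m + n) = toZ m + toZ n.
Proof. by apply/ffunP=> a; rewrite !ffunE PoszD. Qed.

Lemma pistepC a b c : pistep a (pistep b c) = pistep b (pistep a c).
Proof.
rewrite /pistep /= tstepC; congr (_, _).
rewrite [LHS](AC (3*1*1) ((1)*(2*4)*(3*5))) /= -toZD mstepC toZD.
by rewrite [RHS](AC (3*1*1) ((1)*(2*4)*(5*3))).
Qed.

Definition endoQ : finType := {ffun gstate -> gstate}.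
Definition idQ : endoQ := [ffun q => q].
Definition compQ (f g : endoQ) : endoQ := [ffun q => f (g q)].

Definition in_tmonoid (f : endoQ) : Prop := exists w, f = finfun (tword w).
Definition tidempotent (f : endoQ) : bool :=
  `[< in_tmonoid f /\ compQ f f = f >].

Definition eQ : endoQ := \big[compQ/idQ]_(f : endoQ | tidempotent f) f.

Definition locally_recurrent (q : gstate) : Prop := exists q', q = eQ q'.

Definition total_kernel : {pred zvec} := fun z =>
  `[< forall q, locally_recurrent q -> tvec (posv z) q = tvec (negv z) q >].

Definition matrixA : zmodType := {ffun letter * letter -> rat}.

Definition mulA (P : matrixA) (k : zvec) : {ffun letter -> rat} :=
  [ffun a => \sum_b P (a, b) * (k b)%:~R].

Definition is_production_matrix (P : matrixA) : Prop :=
  forall k : nvec, toZ k \in total_kernel ->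
  forall q, locally_recurrent q ->
  mulA P (toZ k) = [ffun a => (mvec k q a)%:R].

(* A definite description: a matrix satisfying is_production_matrix exists and
   is unique when N is locally irreducible.  The default 0 is then not used. *)
Definition production_matrix : matrixA :=
  xget 0 [set P | is_production_matrix P]%classic.

(* The subgroup (I - P) K of Z^A: P k is integral for every k in K. *)
Definition production_lattice : {pred zvec} := fun y =>
  `[< exists2 k, k \in total_kernel &
      forall a, (y a)%:~R = (k a)%:~R - mulA production_matrix k a >].

Lemma tword_cat w w' q : tword (w ++ w') q = tword w' (tword w q).
Proof. exact: foldl_cat. Qed.

Lemma tword_tstep w a q : tword w (tstep a q) = tstep a (tword w q).
Proof. by elim: w q => //= b w IH q; rewrite tstepC IH. Qed.

Lemma twordC w w' q : tword w (tword w' q) = tword w' (tword w q).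
Proof. by elim: w' q => //= a w' IH q; rewrite IH tword_tstep. Qed.

Lemma tword_perm w w' q : perm_eq w w' -> tword w q = tword w' q.
Proof.
elim: w w' q => [|a w IH] w' q E.
  by move: E; rewrite perm_sym => /perm_nilP ->.
have aw' : a \in w' by rewrite -(perm_mem E) mem_head.
case/splitPr: aw' E => w1 w2 E.
have E' : perm_eq w (w1 ++ w2).
  by rewrite -(perm_cons a) (perm_trans E) // -cat1s perm_catCA.
by rewrite /= tword_tstep (IH _ _ E') !tword_cat /= tword_tstep.
Qed.

Lemma count_word_of n a : count_mem a (word_of n) = n a.
Proof.
rewrite /word_of count_flatten -map_comp sumnE big_map big_enum /=.
rewrite (bigD1 a) //= count_nseq /= eqxx mul1n big1 ?addn0 // => b ba.
by rewrite count_nseq /= (negPf ba).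
Qed.

Lemma tvecD m n q : tvec (m + n) q = tvec m (tvec n q).
Proof.
rewrite /tvec -tword_cat; apply: tword_perm; apply/allP=> a _ /=.
by rewrite count_cat !count_word_of !ffunE addrC.
Qed.

Lemma tvecC m n q : tvec m (tvec n q) = tvec n (tvec m q).
Proof. exact: twordC. Qed.

Lemma iter_idem (T : finType) (f : T -> T) :
  exists2 k, (0 < k)%N & forall x, iter k f (iter k f x) = iter k f x.
Proof.
pose F n : {ffun T -> T} := [ffun x => iter n f x].
have [i [p [p0 E]]] : exists i p, (0 < p)%N /\ F (p + i)%N = F i.
  pose g (n : 'I_#|{ffun T -> T}|.+1) := F n.
  have /injectivePn[i [j ij E]] : ~~ injectiveb g.
    apply/negP=> /injectiveP/leq_card.
    by rewrite card_ord ltnn.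
  wlog lt_ij : i j ij E / (i < j)%N.
    move=> H; have [lt|lt|eq] := ltngtP i j; first exact: (H i j).
      by apply: (H j i) => //; rewrite eq_sym.
    by case/eqP: ij; apply: val_inj.
  by exists i, (j - i)%N; rewrite subn_gt0 lt_ij subnK // ltnW.
have step n x : (i <= n)%N -> iter (p + n) f x = iter n f x.
  move=> le; move/ffunP/(_ x): E; rewrite !ffunE => E.
  by rewrite -(subnK le) addnCA iterD E -iterD.
have steps m n x : (i <= n)%N -> iter (m * p + n) f x = iter n f x.
  move=> le; elim: m => // m IH; rewrite mulSn -addnA step ?IH //.
  by rewrite (leq_trans le) // leq_addl.
exists (i.+1 * p)%N; first by rewrite muln_gt0 p0.
move=> x; rewrite -iterD steps //.
by rewrite (leq_trans (leqnSn i)) // leq_pmulr.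
Qed.

Lemma compQ_tmonoid (r : seq endoQ) (p : pred endoQ) :
  (forall f, p f -> in_tmonoid f) ->
  in_tmonoid (\big[compQ/idQ]_(f <- r | p f) f).
Proof.
move=> Hp; elim/big_ind: _ => //.
  by exists [::]; apply/ffunP=> q; rewrite !ffunE.
move=> _ _ [w ->] [w' ->]; exists (w' ++ w).
by apply/ffunP=> q; rewrite !ffunE tword_cat.
Qed.

Lemma in_tmonoid_eQ : in_tmonoid eQ.
Proof. by apply: compQ_tmonoid => f /asboolP[]. Qed.

Lemma tmonoidC f g q : in_tmonoid f -> in_tmonoid g -> f (g q) = g (f q).
Proof. by move=> [w ->] [w' ->]; rewrite !ffunE twordC. Qed.

Lemma eQ_absorb f q : tidempotent f -> f (eQ q) = eQ q.
Proof.
move=> fi; have /asboolP[fm ff] := fi.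
rewrite /eQ; have : f \in index_enum endoQ by rewrite mem_index_enum.
elim: (index_enum _) => // g r IH; rewrite inE big_cons.
have [<-|_] /= := eqVneq f g.
  by move=> _; rewrite fi ffunE -[in RHS]ff [RHS]ffunE.
move=> /IH {}IH; case: ifP => // /asboolP[gm _].
by rewrite ffunE (tmonoidC _ fm gm) IH.
Qed.

Lemma tword_eQ w q : tword w (eQ q) = eQ (tword w q).
Proof.
by have [w' ->] := in_tmonoid_eQ; rewrite !ffunE twordC.
Qed.

Lemma locally_recurrent_tword w q :
  locally_recurrent q -> locally_recurrent (tword w q).
Proof. by move=> [q' ->]; exists (tword w q'); rewrite tword_eQ. Qed.

Lemma tword_inj w q q' : locally_recurrent q -> locally_recurrent q' ->
  tword w q = tword w q' -> q = q'.
Proof.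
have [[//|k] _ Hk] := iter_idem (tword w).
have iterE m x : iter m (tword w) x = tword (flatten (nseq m w)) x.
  by elim: m x => //= m IH x; rewrite tword_cat twordC IH.
have fix_rec x : locally_recurrent x -> iter k.+1 (tword w) x = x.
  move=> [y ->]; rewrite iterE.
  have fi : tidempotent (finfun (tword (flatten (nseq k.+1 w)))).
    apply/asboolP; split; first by exists (flatten (nseq k.+1 w)).
    by apply/ffunP=> z; rewrite !ffunE -!iterE Hk.
  by have := eQ_absorb y fi; rewrite ffunE.
by move=> /fix_rec {2}<- /fix_rec {2}<-; rewrite !iterSr => ->.
Qed.

Lemma total_kernel_closed : zmod_closed total_kernel.
Proof.
split=> [|z w /asboolP zK /asboolP wK].
  by apply/asboolP=> q _; rewrite /negv oppr0.
apply/asboolP=> q qL; set u := z - w.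
have posE (y : zvec) a : (posv y a)%:Z - (negv y a)%:Z = y a.
  by rewrite /negv /posv !ffunE; lia.
have E : posv u + (negv z + posv w) = negv u + (posv z + negv w).
  apply/ffunP=> a; rewrite !ffunE; apply/eqP; rewrite -eqz_nat !PoszD.
  have := posE u a; have := posE z a; have := posE w a.
  rewrite {3}/u !ffunE /=; lia.
have E1 : tvec (negv z + posv w) q = tvec (posv z + negv w) q.
  by rewrite !tvecD wK // tvecC -zK // tvecC.
apply: (@tword_inj (word_of (posv z + negv w))).
- exact: locally_recurrent_tword.
- exact: locally_recurrent_tword.
rewrite -!/(tvec _ _) [LHS]tvecC -E1 -[LHS]tvecD E [LHS]tvecD.
exact: tvecC.
Qed.

HB.instance Definition _ :=
  GRing.isZmodClosed.Build zvec total_kernel total_kernel_closed.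

Lemma mulAB P k l a : mulA P (k - l) a = mulA P k a - mulA P l a.
Proof.
rewrite !ffunE -sumrB; apply: eq_bigr => b _.
by rewrite !ffunE rmorphB mulrBr.
Qed.

Lemma production_lattice_closed : zmod_closed production_lattice.
Proof.
split=> [|y z /asboolP[k kK yE] /asboolP[l lK zE]].
  apply/asboolP; exists 0 => [|a]; first exact: rpred0.
  by rewrite -(subrr (0 : zvec)) mulAB subrr !ffunE subrr subr0.
apply/asboolP; exists (k - l) => [|a]; first exact: rpredB.
have -> : (y - z) a = y a - z a by rewrite !ffunE.
have -> : (k - l) a = k a - l a by rewrite !ffunE.
by rewrite mulAB !rmorphB /= yE zE !opprD opprK addrACA.
Qed.

HB.instance Definition _ :=
  GRing.isZmodClosed.Build zvec production_lattice production_lattice_closed.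

Definition legally_related (c1 c2 : config) : Prop :=
  exists c3, reaches c1 c3 /\ reaches c2 c3.

Lemma legal_cat w w' c : legal (w ++ w') c = legal w c && legal w' (piword w c).
Proof. by elim: w c => //= a w IH c; rewrite IH andbA. Qed.

Lemma piword_cat w w' c : piword (w ++ w') c = piword w' (piword w c).
Proof. exact: foldl_cat. Qed.

Lemma reaches_refl c : reaches c c.
Proof. by exists [::]. Qed.

Lemma reaches_trans c2 c1 c3 : reaches c1 c2 -> reaches c2 c3 -> reaches c1 c3.
Proof.
move=> [w [lw <-]] [w' [lw' <-]]; exists (w ++ w').
by rewrite legal_cat piword_cat lw.
Qed.

Lemma legal_other a b (c : config) : a != b -> 1 <= c.1 a -> 1 <= (pistep b c).1 a.
Proof.
move=> ab; rewrite /= !ffunE /= addn0 eq_sym (negPf ab) subr0 => le.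
by rewrite (le_trans le) // lerDl.
Qed.

Lemma legal_strip a w (c : config) : 1 <= c.1 a -> legal w c ->
  exists2 w', legal w' (pistep a c) &
    piword w' (pistep a c) = piword w c \/
    1 <= (piword w c).1 a /\
      piword w' (pistep a c) = pistep a (piword w c).
Proof.
elim: w c => [|b w IH] c la /=; first by exists [::] => //; right.
move=> /andP[lb lw]; have [E|ab] := eqVneq a b.
  by exists w; rewrite E //; left.
have [w' lw' H] := IH _ (legal_other ab la) lw.
rewrite pistepC in lw' H.
by exists (b :: w') => //=; rewrite legal_other // eq_sym.
Qed.

Lemma reaches_confluent c c1 c2 :
  reaches c c1 -> reaches c c2 -> legally_related c1 c2.
Proof.
move=> [w1 [l1 <-]] [w2 [l2 <-]].
elim: w1 c w2 l1 l2 => [|a w1 IH] c w2 /=.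
  by move=> _ l2; exists (piword w2 c); split; [exists w2 | exact: reaches_refl].
move=> /andP[la l1] l2; have [w' l' H] := legal_strip la l2.
have [d [d1 d2]] := IH _ _ l1 l'; exists d; split => //.
case: H => [<- //|[la2 E]]; rewrite E in d2.
by apply: reaches_trans d2; exists [:: a]; rewrite /= la2.
Qed.

Definition legal_rel : rel config := fun c1 c2 => `[< legally_related c1 c2 >].

Fact legal_rel_refl : reflexive legal_rel.
Proof. by move=> c; apply/asboolP; exists c; split; apply: reaches_refl. Qed.

Fact legal_rel_sym : symmetric legal_rel.
Proof. by move=> c d; apply: asbool_equiv_eq; split=> -[e []]; exists e. Qed.

Fact legal_rel_trans : transitive legal_rel.
Proof.
move=> d c e /asboolP[f [cf df]] /asboolP[g [dg eg]].
have [h [fh gh]] := reaches_confluent df dg.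
apply/asboolP; exists h.
by split; [apply: reaches_trans fh | apply: reaches_trans gh].
Qed.

Canonical legal_equiv :=
  EquivRel legal_rel legal_rel_refl legal_rel_sym legal_rel_trans.

Definition component := {eq_quot legal_rel}.
HB.instance Definition _ := Choice.on component.
HB.instance Definition _ := EqQuotient.on component.

Definition component_of (c : config) : component := \pi_component c.

Lemma component_ofP c d :
  component_of c = component_of d <-> legally_related c d.
Proof.
by split=> [/eqquotP/asboolP //|E]; apply/eqquotP; apply/asboolP.
Qed.

(* Only the values of c and a at indices belonging to I matter; if I has a
   least element, no step leads to it and the letter there is ignored. *)
Definition has_diverse_walk (I : set int) (C : component) : Prop :=
  exists (c : int -> config) (a : int -> letter),
    [/\ forall i, I i -> component_of (c i) = C,
        forall i, I (i - 1) -> I i -> legal_step (a i) (c (i - 1)) (c i)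
      & forall b, infinite_set [set i | [/\ I (i - 1), I i & a i = b]]%classic].

Definition recurrent (C : component) : Prop :=
  [\/ has_diverse_walk [set i | i <= 0]%classic C,
      has_diverse_walk [set i | 0 <= i]%classic C
    | has_diverse_walk [set: int]%classic C].

Definition rec_component := {C : component | `[< recurrent C >]}.
HB.instance Definition _ := Choice.on rec_component.

Definition shift_config (n : nvec) (c : config) : config :=
  (c.1 + toZ n, c.2).

Lemma shift_pistep n a c :
  pistep a (shift_config n c) = shift_config n (pistep a c).
Proof.
by rewrite /pistep /shift_config /=; congr (_, _); rewrite [LHS](ACl (1*3*4*2)).
Qed.

Lemma shift_piword n w c :
  piword w (shift_config n c) = shift_config n (piword w c).
Proof. by elim: w c => //= a w IH c; rewrite shift_pistep IH. Qed.

Lemma shift_le n a (c : config) : 1 <= c.1 a -> 1 <= (shift_config n c).1 a.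
Proof. by move=> le; rewrite /= !ffunE (le_trans le) // lerDl. Qed.

Lemma shift_legal n w c : legal w c -> legal w (shift_config n c).
Proof.
elim: w c => //= a w IH c /andP[la lw].
by rewrite shift_pistep IH // andbT; apply: (@shift_le n).
Qed.

Lemma shift_related n c d : legally_related c d ->
  legally_related (shift_config n c) (shift_config n d).
Proof.
move=> [e [[w [lw <-]] [w' [lw' E]]]]; exists (shift_config n (piword w c)).
split; first by exists w; rewrite shift_piword shift_legal.
by exists w'; rewrite shift_piword E shift_legal.
Qed.

(* By shift_componentE, the choice of the representative is irrelevant. *)
Definition shift_component (n : nvec) (C : component) : component :=
  component_of (shift_config n (repr C)).

Lemma shift_componentE n c :
  shift_component n (component_of c) = component_of (shift_config n c).
Proof.
apply/component_ofP; apply: shift_related; apply/component_ofP.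
by rewrite /component_of reprK.
Qed.

Lemma shift_diverse_walk n I C :
  has_diverse_walk I C -> has_diverse_walk I (shift_component n C).
Proof.
move=> [c [a [cC ca inf]]]; exists (fun i => shift_config n (c i)), a; split=> //.
  by move=> i Ii; rewrite -(cC i Ii) shift_componentE.
move=> i Ii1 Ii; have [le ->] := ca i Ii1 Ii.
by split; [apply: shift_le | rewrite shift_pistep].
Qed.

Lemma shift_recurrent n C : `[< recurrent C >] ->
  `[< recurrent (shift_component n C) >].
Proof.
move=> /asboolP R; apply/asboolP.
by case: R => W; [apply: Or31|apply: Or32|apply: Or33];
  apply: shift_diverse_walk.
Qed.

Definition phi (n : nvec) (C : rec_component) : rec_component :=
  Sub (shift_component n (val C)) (shift_recurrent n (valP C)).

Lemma phiD m n C : phi (m + n) C = phi m (phi n C).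
Proof.
apply: val_inj => /=; rewrite /shift_component -/(shift_component m _).
rewrite shift_componentE; congr component_of; rewrite /shift_config /=.
by rewrite toZD [toZ m + _]addrC addrA.
Qed.

Lemma phi0 : phi 0 = id.
Proof.
apply/funext=> C; apply: val_inj => /=; rewrite -[val C]reprK.
rewrite -/(component_of _) shift_componentE; congr component_of.
rewrite [RHS]surjective_pairing /shift_config; congr (_, _).
by rewrite -[RHS]addr0; congr +%R; apply/ffunP=> a; rewrite !ffunE.
Qed.

(* The image of phi in End(Rec); the monoid operation + is composition. *)
Definition shift_monoid :=
  {f : rec_component -> rec_component | `[< exists n, f = phi n >]}.
HB.instance Definition _ := Choice.on shift_monoid.

Definition shift_of (n : nvec) : shift_monoid :=
  exist _ (phi n) (asboolT (ex_intro _ n erefl)).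

Fact shift_comp_subproof (f g : shift_monoid) :
  `[< exists n, val f \o val g = phi n >].
Proof.
apply/asboolP; have /asboolP[m ->] := valP f; have /asboolP[n ->] := valP g.
by exists (m + n); apply/funext=> C /=; rewrite phiD.
Qed.

Definition shift_comp (f g : shift_monoid) : shift_monoid :=
  exist _ (val f \o val g) (shift_comp_subproof f g).

Fact shift_compA : associative shift_comp.
Proof. by move=> f g h; apply: val_inj. Qed.

Fact shift_compC : commutative shift_comp.
Proof.
move=> f g; apply: val_inj; apply/funext=> C /=.
have /asboolP[m ->] := valP f; have /asboolP[n ->] := valP g.
by rewrite -!phiD addrC.
Qed.

Fact shift_comp0 : left_id (shift_of 0) shift_comp.
Proof. by move=> f; apply: val_inj; rewrite /= phi0. Qed.

HB.instance Definition _ :=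
  GRing.isNmodule.Build shift_monoid shift_compA shift_compC shift_comp0.

Definition shift_group : zmodType := groth shift_monoid.
Definition tor : zmodType := torsion shift_group.

(* The condition that defines C' = g . C. *)
Definition translate (g : tor) (C C' : rec_component) : Prop :=
  forall n n' : nvec, val g = groth_pair (shift_of n) (shift_of n') ->
  phi n C = phi n' C'.

Definition invertible (C : rec_component) : Prop :=
  forall g : tor, exists C', translate g C C'.

Definition inv_component := {C : rec_component | `[< invertible C >]}.

End Network.

(* Main.v *)
From HB Require Import structures.
Require Import Defs.
From mathcomp Require Import all_boot all_order all_algebra finmap.
From mathcomp Require Import zify ring lra.
From mathcomp Require Import boolp classical_sets functions cardinality.

(* Call two configurations similar if they have a common image under possibly
   illegal executions.  The main point is that similar configurations lying in
   recurrent components lie in the same component.  It follows that phi(n) is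
   injective, and that phi(n) = phi(n') as soon as the two maps agree on one
   component, which happens exactly when n - n' is in (I - P)K; everything else
   is formal.

   Gaussian elimination applied to I - P splits the letters into the support of
   some f >= 0 with f <= Pf and the support of some c >= 0 with Pc < c there.
   If a legal word w has at least as many copies of each letter as a word u,
   then executing u (illegally) first and then the rest of w legally leads to
   the same configuration as w; so u preserves the component.  Recurrent
   components have legal words with arbitrarily many copies of each letter.
   Removing multiples of c from such words shows that a recurrent component
   contains configurations with arbitrarily many letters in the support of c,
   while f shows that the letters in its support can be executed legally
   arbitrarily often.  So a recurrent component contains configurations from
   which every prescribed vector can be executed without leaving it, and two
   similar components meet.  Conversely a configuration with enough letters is
   in a recurrent component, because it is reached by repeating c and
   can be continued by repeating f. *)

Set Implicit Arguments.
Unset Strict Implicit.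
Unset Printing Implicit Defensive.

Import Order.TTheory GRing.Theory Num.Theory.
Local Open Scope ring_scope.

(** * Removing letters from legal words *)

Section Words.
Variable N : finite_abelian_network.
Implicit Types (a b : letter N) (u v w : seq (letter N)) (c d : config N).

Lemma piword_pistep w a c : piword w (pistep a c) = pistep a (piword w c).
Proof. by elim: w c => //= b w IH c; rewrite pistepC IH. Qed.

Lemma piwordC w w' c : piword w (piword w' c) = piword w' (piword w c).
Proof. by elim: w' c => //= a w' IH c; rewrite IH piword_pistep. Qed.

Lemma piword_perm w w' c : perm_eq w w' -> piword w c = piword w' c.
Proof.
elim: w w' c => [|a w IH] w' c E.
  by move: E; rewrite perm_sym => /perm_nilP ->.
have aw' : a \in w' by rewrite -(perm_mem E) mem_head.
case/splitPr: aw' E => w1 w2 E.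
have E' : perm_eq w (w1 ++ w2).
  by rewrite -(perm_cons a) (perm_trans E) // -cat1s perm_catCA.
by rewrite /= piword_pistep (IH _ _ E') !piword_cat /= piword_pistep.
Qed.

Lemma perm_occ w w' : occ w = occ w' -> perm_eq w w'.
Proof.
move=> E; apply/allP => a _; apply/eqP.
by have /ffunP/(_ a) := E; rewrite !ffunE.
Qed.

Lemma mword_cat w w' q : mword (w ++ w') q = mword w q + mword w' (tword w q).
Proof.
by elim: w q => [|a w IH] q /=; rewrite ?add0r // IH addrA.
Qed.

Lemma piwordE w c :
  piword w c = (c.1 + toZ (mword w c.2) - toZ (occ w), tword w c.2).
Proof.
elim: w c => [|a w IH] [x q] /=.
  by congr (_, _); apply/ffunP=> b; rewrite !ffunE /= addr0 subr0.
rewrite IH /=; congr (_, _).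
by apply/ffunP=> b; rewrite !ffunE /=; lia.
Qed.

Lemma mword_perm w w' q : perm_eq w w' -> mword w q = mword w' q.
Proof.
move=> E; have := piword_perm (0, q) E; rewrite !piwordE (occ_perm E) /= => -[].
move=> /addIr/addrI/ffunP H _; apply/ffunP=> a.
by have := H a; rewrite !ffunE => -[].
Qed.

Lemma piword_shiftZ w (x z : zvec N) q :
  piword w (x + z, q) = ((piword w (x, q)).1 + z, (piword w (x, q)).2).
Proof.
by rewrite !piwordE /=; congr (_, _); apply/ffunP=> b; rewrite !ffunE; lia.
Qed.

(** Firing [a] in advance takes copies of no other letter, so the steps before the first [a] of [w]
    stay legal; after it both executions coincide. *)
Lemma legal_rem a w c : legal w c -> legal (rem a w) (pistep a c).
Proof.
elim: w c => //= b w IH c /andP[lb lw]; have [<- //|ab] := eqVneq b a.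
by rewrite /= legal_other // pistepC IH.
Qed.

(* The multiset difference; legality is not required of the letters of u. *)
Definition wdiff w u := foldl (fun w a => rem a w) w u.

Lemma legal_wdiff w u c : legal w c -> legal (wdiff w u) (piword u c).
Proof. by elim: u w c => //= a u IH w c lw; apply/IH/legal_rem. Qed.

Lemma count_wdiff w u a : count_mem a (wdiff w u) = (count_mem a w - count_mem a u)%N.
Proof.
elim: u w => [|b u IH] w /=; first by rewrite subn0.
by rewrite IH count_mem_rem subnDA eq_sym.
Qed.

Lemma wdiff_perm w u : (forall a, count_mem a u <= count_mem a w)%N ->
  perm_eq (u ++ wdiff w u) w.
Proof. by move=> le; apply/allP=> a _ /=; rewrite count_cat count_wdiff subnKC. Qed.

Lemma component_reaches c d : reaches c d -> component_of c = component_of d.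
Proof. by move=> r; apply/component_ofP; exists d; split=> //; apply: reaches_refl. Qed.

Lemma reaches_wdiff w u c : legal w c -> (forall a, count_mem a u <= count_mem a w)%N ->
  reaches (piword u c) (piword w c).
Proof.
move=> lw le; exists (wdiff w u); split; first exact: legal_wdiff.
by rewrite -piword_cat; apply: piword_perm; apply: wdiff_perm.
Qed.

Lemma component_removal w u c : legal w c ->
  (forall a, count_mem a u <= count_mem a w)%N ->
  component_of (piword u c) = component_of c.
Proof.
move=> lw le; rewrite (component_reaches (reaches_wdiff lw le)).
by apply/esym/component_reaches; exists w.
Qed.

(** [w1] followed by what [w2] has in excess of it realizes the letterwise maximum. *)
Lemma legal_join w1 w2 c : legal w1 c -> legal w2 c ->
  exists2 w, legal w c &
    forall a, (count_mem a w1 <= count_mem a w)%N && (count_mem a w2 <= count_mem a w)%N.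
Proof.
move=> l1 l2; exists (w1 ++ wdiff w2 w1); first by rewrite legal_cat l1 legal_wdiff.
by move=> a; rewrite count_cat count_wdiff; lia.
Qed.

Lemma legal_joins k c :
  (forall a, exists2 w, legal w c & (k <= count_mem a w)%N) ->
  exists2 w, legal w c & forall a, (k <= count_mem a w)%N.
Proof.
move=> H; suff [w lw le] : exists2 w, legal w c &
    forall a, a \in enum (letter N) -> (k <= count_mem a w)%N.
  by exists w => // a; apply: le; rewrite mem_enum.
elim: (enum _) => [|a s [w lw IH]]; first by exists [::].
have [w' lw' le'] := H a; have [v lv le] := legal_join lw lw'.
exists v => // b; have /andP[le1 le2] := le b.
rewrite inE => /predU1P[E|/IH/leq_trans]; last exact.
by apply: leq_trans le2; rewrite E.
Qed.

Lemma legal_plenty w c :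
  (forall a, a \in w -> (count_mem a w)%:Z <= c.1 a) -> legal w c.
Proof.
elim: w c => //= b w IH c H; apply/andP; split.
  by have := H b (mem_head _ _); rewrite eqxx; lia.
apply: IH => a aw; have := H a; rewrite inE aw orbT => /(_ isT).
rewrite /= !ffunE /= addn0; lia.
Qed.

(** Just before its last occurrence [a] has at least one copy, of which that step takes only one;
    later steps can only add copies. *)
Lemma fired_ge0 w c a : legal w c -> a \in w -> 0 <= (piword w c).1 a.
Proof.
elim: w c => //= b w IH c /andP[lb lw]; rewrite inE.
have [aw _|aw] := boolP (a \in w); first exact: IH.
rewrite orbF => /eqP ab; move: lb; rewrite -ab piwordE => /= lb.
move/count_memPn: aw => aw.
by rewrite !ffunE /= addn0 eqxx aw; lia.
Qed.

Definition sim c d := exists v v', piword v c = piword v' d.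

Lemma sim_trans d c e : sim c d -> sim d e -> sim c e.
Proof.
move=> [v [v' E]] [u [u' E']]; exists (v ++ u), (u' ++ v').
by rewrite !piword_cat E piwordC E' piwordC.
Qed.

Lemma component_sim c d : component_of c = component_of d -> sim c d.
Proof.
by move=> /component_ofP[e [[w [_ <-]] [w' [_ E]]]]; exists w, w'.
Qed.

Lemma sim_shiftZ z (x y : zvec N) q r :
  sim (x, q) (y, r) -> sim (x + z, q) (y + z, r).
Proof. by move=> [v [v' E]]; exists v, v'; rewrite !piword_shiftZ E. Qed.

(** A finite consequence of recurrence common to the three kinds of walks. The configuration may
    depend on [k], since a walk indexed by nonpositive integers has no first one. *)
Definition ample (C : component N) := forall k : nat, exists c w,
  [/\ component_of c = C, legal w c & forall a, (k <= count_mem a w)%N].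

End Words.

(** * Locally recurrent states and the production matrix *)

Section Local.
Variable N : finite_abelian_network.
Implicit Types (a b : letter N) (u v w : seq (letter N)) (c d : config N).
Implicit Types (q r : gstate N).

Lemma locally_recurrent_word : exists u, forall q, locally_recurrent (tword u q).
Proof.
have [u E] := in_tmonoid_eQ N; exists u => q; exists q.
by rewrite E ffunE.
Qed.

(** Executing first a word [u] that makes every state locally recurrent keeps the component and
    costs at most [size u] copies of each letter. *)
Lemma ample_locally_recurrent (C : component N) (k : nat) : ample C -> exists c w,
  [/\ component_of c = C, locally_recurrent c.2, legal w c
    & forall a, (k <= count_mem a w)%N].
Proof.
move=> Ca; have [u uP] := locally_recurrent_word.
have [c [w [<- lw le]]] := Ca (k + size u)%N.
have szu a : (count_mem a u <= size u)%N := count_size _ _.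
exists (piword u c), (wdiff w u); split.
- by apply: (component_removal lw) => a; have := le a; have := szu a; lia.
- rewrite piwordE; exact: uP.
- exact: legal_wdiff.
- by move=> a; rewrite count_wdiff; have := le a; have := szu a; lia.
Qed.

Lemma tword_flatten_nseq k w q : tword (flatten (nseq k w)) q = iter k (tword w) q.
Proof. by elim: k q => //= k IH q; rewrite tword_cat IH -iterSr. Qed.

Lemma tword_nseq k a q : tword (nseq k a) q = iter k (tstep a) q.
Proof. by elim: k q => //= k IH q; rewrite IH -iterSr. Qed.

(** Some power of [tword w] is idempotent, and [tword w] is injective on the locally recurrent
    states, where an injective idempotent is the identity. *)
Lemma tword_period w : exists2 k, (0 < k)%N &
  forall q, locally_recurrent q -> iter k (tword w) q = q.
Proof.
have [k k0 Hk] := iter_idem (tword w); exists k => // q qL.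
apply: (@tword_inj N (flatten (nseq k w))) => //.
  by rewrite -tword_flatten_nseq; apply: locally_recurrent_tword.
by rewrite !tword_flatten_nseq.
Qed.

Lemma tstep_period : exists2 m, (0 < m)%N &
  forall a q, locally_recurrent q -> iter m (tstep a) q = q.
Proof.
have H a : exists k, (0 < k)%N /\
    forall q, locally_recurrent q -> iter k (tstep a) q = q.
  by have [k k0 kP] := tword_period [:: a]; exists k.
have [K KP] := choice H.
exists (\prod_a K a)%N; first by apply: prodn_gt0 => a; case: (KP a).
move=> a q qL; rewrite (bigD1 a) //= mulnC.
elim: (\prod_(_ | _) _)%N => //= n IH.
by rewrite mulSn iterD IH; case: (KP a) => _; apply.
Qed.

Lemma piword_flatten_nseq w (z : zvec N) k c :
  (forall d, locally_recurrent d.2 -> piword w d = (d.1 + z, d.2)) ->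
  locally_recurrent c.2 ->
  piword (flatten (nseq k w)) c = (c.1 + z *+ k, c.2).
Proof.
move=> wP; elim: k c => [|k IH] c cL /=; first by rewrite addr0 -surjective_pairing.
by rewrite piword_cat wP // IH //= mulrS addrA.
Qed.

Definition loop w := forall q, locally_recurrent q -> tword w q = q.

Lemma tword_return w q : locally_recurrent q ->
  exists u, tword u (tword w q) = q.
Proof.
move=> qL; have [[//|k] _ kP] := tword_period w.
by exists (flatten (nseq k w)); rewrite tword_flatten_nseq -iterSr kP.
Qed.

Section Irreducible.
Hypothesis Nirr : locally_irreducible N.

Lemma tword_transitive q r : locally_recurrent q -> locally_recurrent r ->
  exists w, tword w q = r.
Proof.
move=> qL rL; have [w [w' E]] := Nirr q r.
have [u uE] := tword_return w' rL.
by exists (w ++ u); rewrite tword_cat E.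
Qed.

(* The states t_w commute and act transitively on the locally recurrent states. *)
Lemma tword_eq_all w w' q : locally_recurrent q -> tword w q = tword w' q ->
  forall r, locally_recurrent r -> tword w r = tword w' r.
Proof.
move=> qL E r rL; have [u <-] := tword_transitive qL rL.
by rewrite twordC E twordC.
Qed.

Lemma loopP w q : locally_recurrent q -> tword w q = q -> loop w.
Proof. by move=> qL E r rL; apply: (@tword_eq_all w [::] q). Qed.

(** Let [u] lead from [q] to [r]. Since [w] fixes [q], the word [u] sends the same messages from [q]
    in [w ++ u] as in [u ++ w]; what remains are the messages of [w] from [q] and from [r]. *)
Lemma mword_loop w q r : loop w -> locally_recurrent q -> locally_recurrent r ->
  mword w q = mword w r.
Proof.
move=> wl qL rL; have [u <-] := tword_transitive qL rL.
have /(mword_perm q) : perm_eq (w ++ u) (u ++ w) by rewrite perm_catC.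
rewrite !mword_cat wl // addrC => /ffunP E; apply/ffunP => a.
by have := E a; rewrite !ffunE; apply: addnI.
Qed.

Lemma occ_word_of (n : nvec N) : occ (word_of n) = n.
Proof. by apply/ffunP => a; rewrite ffunE count_word_of. Qed.

Lemma tword_occ w q : tvec (occ w) q = tword w q.
Proof. by apply/tword_perm/perm_occ; rewrite occ_word_of. Qed.

Lemma mword_occ w q : mvec (occ w) q = mword w q.
Proof. by apply/mword_perm/perm_occ; rewrite occ_word_of. Qed.

Lemma posv_toZ (n : nvec N) : posv (toZ n) = n.
Proof. by apply/ffunP=> a; rewrite !ffunE; lia. Qed.

Lemma negv_toZ (n : nvec N) : negv (toZ n) = 0.
Proof. by apply/ffunP=> a; rewrite !ffunE; lia. Qed.

Lemma posvB_negv (z : zvec N) : toZ (posv z) - toZ (negv z) = z.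
Proof. by apply/ffunP=> a; rewrite !ffunE; lia. Qed.

Lemma tvec0 q : tvec 0 q = q.
Proof.
have -> : 0 = occ [::] :> nvec N by apply/ffunP=> a; rewrite !ffunE.
by rewrite tword_occ.
Qed.

Lemma loop_total_kernel w : loop w <-> toZ (occ w) \in @total_kernel N.
Proof.
split=> [wl|/asboolP H q qL].
  by apply/asboolP=> q qL; rewrite posv_toZ negv_toZ tword_occ wl // tvec0.
by have := H q qL; rewrite posv_toZ negv_toZ tword_occ tvec0.
Qed.

Lemma exists_locally_recurrent : exists q, locally_recurrent q.
Proof.
have q0 (v : vertex N) : {q : state v | true}.
  by case: (pickP (state v)) (state_gt0 v) => [q _ _|/eq_card0 ->//]; exists q.
pose q : gstate N := [ffun v => sval (q0 v)].
by have [u uP] := locally_recurrent_word; exists (tword u q).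
Qed.

Lemma nvec_mulrnE (n : nvec N) k a : (n *+ k) a = (n a * k)%N.
Proof. by rewrite ffunMnE; elim: k => [|k IH]; rewrite ?muln0 // mulrS IH mulnS. Qed.

(** Here [m] is a common period of the letters and [G a] counts the messages sent by [m] copies of
    [a]. *)
Lemma multiple_loops : exists (m : nat) (G : letter N -> nvec N), (0 < m)%N /\
  forall n : nvec N, loop (word_of (n *+ m)) /\
    forall q, locally_recurrent q -> mvec (n *+ m) q = \sum_a G a *+ n a.
Proof.
have [m m0 mP] := tstep_period; have [q0 q0L] := exists_locally_recurrent.
exists m, (fun a => mword (nseq m a) q0); split=> // n.
have Gl a k : loop (nseq (k * m) a).
  move=> q qL; elim: k => // k IH.
  by rewrite mulSn nseqD tword_cat (tword_nseq m) mP.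
have GM a k q : locally_recurrent q ->
    mword (nseq (k * m) a) q = mword (nseq m a) q0 *+ k.
  move=> qL; elim: k => // k IH; rewrite mulSn nseqD mword_cat mulrS.
  by rewrite (tword_nseq m) mP // IH (@mword_loop _ q q0) // -[m]mul1n.
suff H q : locally_recurrent q ->
    tvec (n *+ m) q = q /\ mvec (n *+ m) q = \sum_a mword (nseq m a) q0 *+ n a.
  by split=> q /H[].
move=> qL; rewrite /mvec /tvec /word_of -big_enum /=.
elim: (enum _) => [|a s [IHt IHm]] /=; first by rewrite big_nil.
by rewrite nvec_mulrnE tword_cat mword_cat big_cons Gl // IHt IHm GM.
Qed.

(** The messages of [k *+ m] are counted twice: as those of [m] repetitions of the loop [k], and
    letter by letter through [G]. *)
Lemma production_matrix_exists : exists P : matrixA N, is_production_matrix P.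
Proof.
have [m [G [m0 GP]]] := multiple_loops.
exists [ffun ab => (G ab.2 ab.1)%:R / m%:R] => k kK q qL.
have kl : loop (word_of k) by apply/loop_total_kernel; rewrite occ_word_of.
have E : mvec (k *+ m) q = mvec k q *+ m.
  have -> : k *+ m = occ (flatten (nseq m (word_of k))).
    elim: m {m0 GP} => [|m IH] /=; first by apply/ffunP=> a; rewrite !ffunE.
    by rewrite occ_cat -IH occ_word_of mulrS.
  rewrite mword_occ; elim: m {m0 GP} => //= m IH.
  by rewrite mword_cat kl // IH mulrS.
apply/ffunP=> a; rewrite !ffunE; apply: (@mulIf _ m%:R); first by rewrite pnatr_eq0; lia.
have [_ /(_ q qL)] := GP k; rewrite E => /ffunP/(_ a).
move=> /(congr1 (fun n : nat => n%:R : rat)).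
rewrite nvec_mulrnE natrM => ->; rewrite sum_ffunE natr_sum mulr_suml.
apply: eq_bigr => b _; rewrite nvec_mulrnE natrM !ffunE /= mulrAC.
by rewrite divfK // pnatr_eq0; lia.
Qed.

(** Appending the same return word [u] to both words turns them into loops, where the defining
    property of the matrix applies; the contributions of [u] cancel. *)
Lemma mulA_production (w w' : seq (letter N)) q a :
  locally_recurrent q -> tword w q = tword w' q ->
  Defs.mulA (production_matrix N) (toZ (occ w) - toZ (occ w')) a
  = (mword w q a)%:R - (mword w' q a)%:R.
Proof.
move=> qL E; have PP : is_production_matrix (production_matrix N).
  exact: (@xgetPex _ 0 [set P | is_production_matrix P]%classic production_matrix_exists).
have [u uE] := tword_return w qL.
have H v : tword v q = tword w q ->
    Defs.mulA (production_matrix N) (toZ (occ (v ++ u))) a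
    = (mword v q a)%:R + (mword u (tword w q) a)%:R.
  move=> vE; have ul : loop (v ++ u) by apply: (loopP qL); rewrite tword_cat vE.
  have /ffunP/(_ a) := PP _ ((loop_total_kernel _).1 ul) q qL.
  by rewrite mword_occ mword_cat vE => ->; rewrite !ffunE natrD.
have -> : toZ (occ w) - toZ (occ w') = toZ (occ (w ++ u)) - toZ (occ (w' ++ u)).
  by rewrite !occ_cat !toZD opprD addrACA subrr addr0.
by rewrite mulAB !H // opprD addrACA subrr addr0.
Qed.

Lemma total_kernelP w w' q : locally_recurrent q -> tword w q = tword w' q ->
  toZ (occ w) - toZ (occ w') \in @total_kernel N.
Proof.
move=> qL E; have [u uE] := tword_return w qL.
have H v : tword v q = tword w q -> toZ (occ (v ++ u)) \in @total_kernel N.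
  by move=> vE; apply/loop_total_kernel/(loopP qL); rewrite tword_cat vE.
have -> : toZ (occ w) - toZ (occ w') = toZ (occ (w ++ u)) - toZ (occ (w' ++ u)).
  by rewrite !occ_cat !toZD opprD addrACA subrr addr0.
by apply: rpredB; apply: H.
Qed.

(** If [k] is the difference of the letter counts of the two words, equality of the final letters
    reads n - n' = k - Pk. Conversely, the positive and negative parts of [k] serve as the two
    words. *)
Lemma production_latticeP (n n' : nvec N) (x : zvec N) q : locally_recurrent q ->
  sim (x + toZ n, q) (x + toZ n', q) <->
  toZ n - toZ n' \in @production_lattice N.
Proof.
move=> qL; split=> [[v [v']]|/asboolP[k kK H]].
  rewrite !piwordE /= => -[/ffunP E tE]; apply/asboolP.
  exists (toZ (occ v) - toZ (occ v')); first exact: total_kernelP tE.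
  move=> a; rewrite (mulA_production a qL tE).
  have /(congr1 (fun z : int => z%:~R : rat)) := E a; rewrite !ffunE.
  rewrite !rmorphB !rmorphD /= !pmulrn; lra.
have tE : tword (word_of (posv k)) q = tword (word_of (negv k)) q.
  by move/asboolP: kK; apply.
exists (word_of (posv k)), (word_of (negv k)); rewrite !piwordE /= tE.
congr (_, _); apply/ffunP=> a; have := H a.
have := mulA_production a qL tE; rewrite !occ_word_of posvB_negv => -> {}H.
have kE : k a = (posv k a)%:Z - (negv k a)%:Z by rewrite !ffunE; lia.
rewrite {}kE in H; apply: (@intr_inj rat); move: H; rewrite !ffunE.
rewrite !rmorphB !rmorphD /= !pmulrn; lra.
Qed.

End Irreducible.
End Local.

(** * Expanding and contracting vectors *)

Section NonnegativeMatrix.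
Variables (R : realFieldType) (T : finType) (P : T -> T -> R).
Hypothesis P_ge0 : forall a b, 0 <= P a b.
Implicit Types (S : {set T}) (f c d : T -> R).

Definition mulP f a := \sum_b P a b * f b.

Lemma mulPD f c a : mulP (fun b => f b + c b) a = mulP f a + mulP c a.
Proof. by rewrite -big_split; apply: eq_bigr => b _; rewrite mulrDr. Qed.

Lemma mulPZ t f a : mulP (fun b => t * f b) a = t * mulP f a.
Proof. by rewrite mulr_sumr; apply: eq_bigr => b _; rewrite mulrCA. Qed.

Lemma mulP_delta b a : mulP (fun x => (x == b)%:R) a = P a b.
Proof.
rewrite /mulP (bigD1 b) //= eqxx mulr1 big1 ?addr0 // => x /negPf ->.
by rewrite mulr0.
Qed.

Lemma mulP_ge0 f a : (forall b, 0 <= f b) -> 0 <= mulP f a.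
Proof. by move=> f0; apply: sumr_ge0 => b _; apply: mulr_ge0. Qed.

(* Gaussian elimination of one element at a time; the pivot at each step is
   either positive or yields the first alternative. *)
Lemma M_matrix_alternative S :
  (exists f, [/\ forall a, 0 <= f a, exists a, 0 < f a,
     forall a, 0 < f a -> a \in S & forall a, a \in S -> f a <= mulP f a]) \/
  (forall d, (forall a, 0 <= d a) -> exists c, [/\ forall a, 0 <= c a,
     forall a, 0 < c a -> a \in S & forall a, a \in S -> c a - mulP c a = d a]).
Proof.
have [n] := ubnP #|S|; elim: n S => // n IH S; rewrite ltnS => Sn.
have [->|[a aS]] := set_0Vmem S.
  right=> d d0; exists (fun=> 0); split=> // a; rewrite ?ltxx ?inE //.
have [[f [f0 fpos fS fP]]|IHS] := IH (S :\ a) (leq_trans (proper_card (properD1 aS)) Sn).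
  left; exists f; split=> // b; first by move=> /fS; rewrite inE => /andP[].
  move=> bS; have [->|ba] := eqVneq b a; last by apply: fP; rewrite !inE ba.
  have fa : ~~ (0 < f a) by apply/negP => /fS; rewrite !inE eqxx.
  by apply: le_trans (mulP_ge0 _ f0); rewrite leNgt.
have [c [c0 cS cP]] := IHS (fun x => P x a) (fun=> P_ge0 _ _).
(* On [S :\ a] this vector satisfies v = Pv, so [s] below is the pivot left in row [a]. *)
pose v x := c x + (x == a)%:R.
have v0 x : 0 <= v x by rewrite addr_ge0.
have vS x : 0 < v x -> x \in S.
  have [-> //|xa] := eqVneq x a; rewrite /v (negPf xa) addr0 => /cS.
  by rewrite !inE => /andP[].
have vP x : v x - mulP v x = c x - mulP c x + (x == a)%:R - P x a.
  by rewrite mulPD mulP_delta /v; ring.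
have ca : c a = 0.
  apply/eqP; rewrite eq_le c0 andbT leNgt; apply/negP => /cS.
  by rewrite !inE eqxx.
pose s := v a - mulP v a.
have vP0 x : x \in S -> x != a -> v x = mulP v x.
  move=> xS xa; apply/eqP; rewrite -subr_eq0 vP cP ?inE ?xa //.
  by rewrite (negPf xa) addr0 subrr.
have [s0|s0] := leP s 0.
  left; exists v; split=> //; first by exists a; rewrite /v ca eqxx add0r.
  move=> x xS; have [->|xa] := eqVneq x a; last by rewrite -vP0.
  by rewrite -subr_le0.
right=> d d0; have [e [e0 eS eP]] := IHS d d0.
have ea : e a = 0.
  apply/eqP; rewrite eq_le e0 andbT leNgt; apply/negP => /eS.
  by rewrite !inE eqxx.
(* Chosen to make row [a] exact: there e - Pe equals -Pe because [e a = 0]. Adding multiples of [v]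
   leaves the other rows of [S] unchanged. *)
pose t := (d a + mulP e a) / s.
have t0 : 0 <= t by apply: divr_ge0 (ltW s0); apply: addr_ge0 (d0 a) (mulP_ge0 _ e0).
exists (fun x => e x + t * v x); split=> [x|x|x xS].
- by rewrite addr_ge0 // mulr_ge0.
- apply: contraTT => xS; rewrite -leNgt.
  have := contra (@vS x) xS; rewrite -leNgt => vx.
  have : ~~ (0 < e x).
    by apply: contra xS => /eS; rewrite inE => /andP[].
  by rewrite -leNgt => ex; rewrite -(addr0 0) lerD // mulr_ge0_le0.
have -> : e x + t * v x - mulP (fun x => e x + t * v x) x
  = (e x - mulP e x) + t * (v x - mulP v x) by rewrite mulPD mulPZ; ring.
have [->|xa] := eqVneq x a.
  by rewrite ea -/s divfK ?gt_eqF // ; ring.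
by rewrite -vP0 // subrr mulr0 addr0 eP // !inE xa.
Qed.

(** Starting from [f = 0], solutions of the first alternative on the zero set of [f] are added to
    [f], which shrinks that set. When none exists, the second alternative with right-hand side 1
    gives [c] on the zero set. *)
Lemma expanding_contracting_vectors : exists f c,
  [/\ forall a, 0 <= f a, forall a, 0 <= c a, forall a, f a <= mulP f a,
      forall a, 0 < c a -> mulP c a < c a & forall a, 0 < f a \/ 0 < c a].
Proof.
suff H n f : (forall a, 0 <= f a) -> (forall a, f a <= mulP f a) ->
    (#|[set a | (f a <= 0)%R]| < n)%N -> exists f c,
    [/\ forall a, 0 <= f a, forall a, 0 <= c a, forall a, f a <= mulP f a,
      forall a, 0 < c a -> mulP c a < c a & forall a, 0 < f a \/ 0 < c a].
  by apply: (H _ (fun=> 0) _ _ (ltnSn _)) => // a; apply: mulP_ge0.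
elim: n f => // n IH f f0 fP; rewrite ltnS => fn.
have [[g [g0 [a ga] gS gP]]|H] := M_matrix_alternative [set a | f a <= 0].
  have gP' b : g b <= mulP g b.
    have [|/negPf bS] := boolP (b \in [set a | f a <= 0]); first exact: gP.
    apply: le_trans (mulP_ge0 b g0); rewrite leNgt; apply/negP => /gS.
    by rewrite bS.
  apply: (IH (fun b => f b + g b)) => [b|b|]; first exact: addr_ge0.
    by rewrite mulPD lerD.
  apply: leq_trans fn; apply/proper_card/properP; split.
    by apply/fintype.subsetP => b; rewrite !inE; apply: le_trans; rewrite lerDl.
  by exists a; [apply: gS | rewrite inE -ltNge ltr_wpDl].
have [c [c0 cS cP]] := H (fun=> 1) (fun=> ler01).
have cP1 a : a \in [set a | f a <= 0] -> mulP c a < c a.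
  by move=> /cP; lra.
exists f, c; split=> // [a /cS/cP1 //|a].
have [fa|fa] := ltP 0 (f a); [by left | right].
by apply: le_lt_trans (mulP_ge0 a c0) (cP1 a _); rewrite inE.
Qed.

End NonnegativeMatrix.

Lemma common_denominator (T : finType) (f : T -> rat) : (forall a, 0 <= f a) ->
  exists (d : nat) (n : T -> nat), (0 < d)%N /\ forall a, f a * d%:R = (n a)%:R.
Proof.
move=> f0; pose d := (\prod_a `|denq (f a)|)%N.
have dz : (0 < d)%N by apply: prodn_gt0 => a; rewrite absz_gt0 denq_neq0.
exists d, (fun a => `|numq (f a)| * \prod_(b | b != a) `|denq (f b)|)%N; split=> // a.
rewrite /d (bigD1 a) //= !natrM mulrA; congr (_ * _).
rewrite !natr_absz (gtr0_norm (denq_gt0 _)) ger0_norm ?numq_ge0 //.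
by rewrite -{1}(divq_num_den (f a)) divfK // intr_eq0 denq_neq0.
Qed.


(** * Words that change the letters but preserve the locally recurrent states *)

Section Drift.
Variable N : finite_abelian_network.
Hypothesis Nirr : locally_irreducible N.

(** Clearing denominators in [f] and [c] and multiplying by the period [m] gives loops. Then f <= Pf
    makes the net gain [phi] of [wf] nonnegative, and Pc < c makes [wb] lose at least one copy of
    each of its own letters. *)
Lemma drift_words : exists (wf wb : seq (letter N)) (phi : nvec N) (psi : zvec N),
  [/\ forall c : config N, locally_recurrent c.2 -> piword wf c = (c.1 + toZ phi, c.2),
      forall c : config N, locally_recurrent c.2 -> piword wb c = (c.1 - psi, c.2),
      forall a, a \in wb -> 1 <= psi a & forall a, a \in wf \/ a \in wb].
Proof.
have [m [G [m0 GP]]] := multiple_loops Nirr.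
pose P a b : rat := (G b a)%:R / m%:R.
have P0 a b : 0 <= P a b by rewrite divr_ge0.
have [f [c [f0 c0 fP cP fc]]] := expanding_contracting_vectors P0.
pose S (g : letter N -> nat) : nvec N := \sum_b G b *+ g b.
have mulPE g (d : nat) (n : letter N -> nat) a : (forall b, g b * d%:R = (n b)%:R) ->
    mulP P g a * d%:R * m%:R = (S n a)%:R.
  move=> gn; rewrite sum_ffunE natr_sum !mulr_suml; apply: eq_bigr => b _.
  rewrite nvec_mulrnE natrM -gn /P; field.
  by rewrite pnatr_eq0; lia.
have [d [n [d0 dn]]] := common_denominator f0.
have [e [k [e0 ek]]] := common_denominator c0.
pose w (n : letter N -> nat) := word_of ((finfun n : nvec N) *+ m).
have wP g (x : config N) : locally_recurrent x.2 -> piword (w g) x =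
    (x.1 + toZ (S g) - toZ ((finfun g : nvec N) *+ m), x.2).
  move=> xL; rewrite piwordE occ_word_of -/(mvec _ _).
  have [-> // ->//] := GP (finfun g); congr (_ + toZ _ - _, _).
  by apply: eq_bigr => b _; rewrite ffunE.
have w_mem g a : (a \in w g) = (0 < g a)%N.
  by rewrite -has_pred1 has_count count_word_of nvec_mulrnE ffunE muln_gt0 m0 andbT.
have dm0 (t : nat) : (0 < t)%N -> (0 : rat) < t%:R * m%:R.
  by move=> t0; rewrite -natrM ltr0n muln_gt0 t0.
(* The truncated subtraction in [phi] is exact, by the inequality from f <= Pf proved in the first
   case. *)
exists (w n), (w k), [ffun a => (S n a - n a * m)%N],
  (toZ ((finfun k : nvec N) *+ m) - toZ (S k)); split.
- move=> x xL; rewrite wP //; congr (_, _); apply/ffunP=> a.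
  suff : (n a * m <= S n a)%N.
    by rewrite !ffunE nvec_mulrnE ffunE; lia.
  rewrite -(ler_nat rat) natrM -dn -(mulPE f d) // -!mulrA ler_pM2r ?dm0 //.
- by move=> x xL; rewrite wP // opprB addrA.
- move=> a; rewrite w_mem => ka.
  suff : (S k a < k a * m)%N.
    by rewrite !ffunE nvec_mulrnE ffunE; lia.
  rewrite -(ltr_nat rat) natrM -ek -(mulPE c e) // -!mulrA ltr_pM2r ?dm0 //.
  by apply: cP; rewrite -(@pmulr_lgt0 _ e%:R) ?ek ltr0n.
move=> a; rewrite !w_mem -!(ltr0n rat) -dn -ek.
by case: (fc a) => H; [left | right]; rewrite mulr_gt0 // ltr0n.
Qed.

End Drift.

(** * Recurrent components have long legal words *)

Section Recurrence.
Variable N : finite_abelian_network.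
Implicit Types (a b : letter N) (u v w : seq (letter N)) (c d : config N).

Lemma walk_legal (c : int -> config N) (a : int -> letter N) (s : int) (n : nat) :
  (forall j, (j < n)%N ->
    legal_step (a (s + j%:Z + 1)) (c (s + j%:Z)) (c (s + j%:Z + 1))) ->
  legal [seq a (s + j%:Z + 1) | j <- iota 0 n] (c s).
Proof.
elim: n s => // n IH s H; rewrite -[n.+1]/(1 + n)%N iotaD map_cat legal_cat /=.
have [le E] := H 0 (ltn0Sn _); rewrite addr0 in le E.
rewrite addr0 le -E /= (iotaDl 1 0) -map_comp.
rewrite (@eq_map _ _ _ (fun j : nat => a (s + 1 + j%:Z + 1))); last first.
  by move=> j /=; rewrite PoszD addrA.
by apply: IH => j jn; have := H j.+1 jn; rewrite -add1n PoszD addrA.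
Qed.

Lemma diverse_walk_ample I (C : component N) :
  (forall M : nat, exists (s : int) (n : nat),
     (forall j : nat, (j <= n)%N -> I (s + j%:Z)) /\
     (forall i, I (i - 1) -> I i -> (`|i| <= M)%N -> s < i /\ i <= s + n%:Z)) ->
  has_diverse_walk I C -> ample C.
Proof.
move=> HI [c [a [cC ca inf]]] k.
have H b : exists L : seq int, [/\ uniq L, size L = k &
    forall i, i \in L -> [/\ I (i - 1), I i & a i = b]].
  have [B BS Bk] := infinite_set_fset k (inf b).
  exists (take k (enum_fset B)); split; first exact/take_uniq/fset_uniq.
    by rewrite size_takel.
  by move=> i /mem_take iB; apply: BS.
have [L LP] := choice H.
pose M := \max_b \max_(i <- L b) `|i|%N.
have LM b i : i \in L b -> (`|i| <= M)%N.
  move=> iL; apply: leq_trans (leq_bigmax (F := fun b => \max_(i <- L b) `|i|%N) b).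
  by apply: (@leq_bigmax_seq _ _ _ (fun i : int => `|i|%N)).
have [s [n [sI sM]]] := HI M.
exists (c s), [seq a (s + j%:Z + 1) | j <- iota 0 n]; split.
- by apply: cC; have := sI 0 isT; rewrite addr0.
- apply: walk_legal => j jn.
  have := ca (s + j%:Z + 1); rewrite addrK; apply; first exact/sI/ltnW.
  by have := sI j.+1 jn; rewrite -addn1 PoszD addrA.
move=> b; have [Lu <- Lb] := LP b.
(* The letter at index [i] stands at position i - s - 1 of the word. *)
rewrite count_map -size_filter -(size_map (fun i : int => absz (i - s - 1)%R)).
apply: uniq_leq_size.
  rewrite map_inj_in_uniq // => i j iL jL.
  have [Ii1 Ii _] := Lb i iL; have [Ij1 Ij _] := Lb j jL.
  have := sM i Ii1 Ii (LM b i iL); have := sM j Ij1 Ij (LM b j jL); lia.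
move=> _ /mapP[i iL ->]; have [Ii1 Ii ai] := Lb i iL.
have [si sn] := sM i Ii1 Ii (LM b i iL).
rewrite mem_filter mem_iota /= add0n; apply/andP; split; last by lia.
by rewrite -ai; apply/eqP; congr (a _); lia.
Qed.

Lemma recurrent_ample (C : component N) : recurrent C -> ample C.
Proof.
case; apply: diverse_walk_ample => M.
- exists (- (M.+1)%:Z), M.+1; split=> [j|i] /=; lia.
- exists 0, M; split=> [j|i] /=; lia.
exists (- (M.+1)%:Z), (M.+1 + M)%N; split=> [j|i] //=; lia.
Qed.

End Recurrence.

(** * Similar recurrent components are equal *)

Lemma le_add_mulrn (x y : int) (k : nat) : 0 <= x -> 1 <= y -> k%:Z <= x + y *+ k.
Proof.
by move=> x0 y1; have -> : y *+ k = k%:Z * y; [rewrite -mulr_natl natz | nia].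
Qed.

Section Drifting.
Variable N : finite_abelian_network.
Variables (wf wb : seq (letter N)) (phi : nvec N) (psi : zvec N).
Hypothesis wfP : forall c : config N, locally_recurrent c.2 ->
  piword wf c = (c.1 + toZ phi, c.2).
Hypothesis wbP : forall c : config N, locally_recurrent c.2 ->
  piword wb c = (c.1 - psi, c.2).
Hypothesis psi_gt0 : forall a, a \in wb -> 1 <= psi a.
Hypothesis wfb : forall a, a \in wf \/ a \in wb.
Implicit Types (a b : letter N) (u v w : seq (letter N)) (c d : config N).

(* With w2 := wdiff w wf: since piword wf d >= d, both w and w2 are legal for
   piword wf d, and w2 leads it to piword w d.  The rest of w after w2, which
   counts as many letters as wf, is therefore legal for piword w d. *)
Lemma legal_extend d w : locally_recurrent d.2 -> legal w d ->
  (forall a, count_mem a wf <= count_mem a w)%N ->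
  exists2 v, legal (w ++ v) d & forall a, count_mem a v = count_mem a wf.
Proof.
move=> dL lw le; pose w2 := wdiff w wf.
exists (wdiff w w2) => [|a]; last by rewrite !count_wdiff subKn.
rewrite legal_cat lw /=.
have -> : piword w d = piword w2 (piword wf d).
  by rewrite -piword_cat; apply: piword_perm; rewrite perm_sym wdiff_perm.
apply: legal_wdiff; rewrite wfP //; exact: (@shift_legal _ phi).
Qed.

Lemma unbounded_transfer a c d : component_of c = component_of d ->
  (forall k, exists2 w, legal w d & (k <= count_mem a w)%N) ->
  forall k, exists2 w, legal w c & (k <= count_mem a w)%N.
Proof.
move=> /component_ofP[e [[u [lu uE]] [v [lv vE]]]] H k.
have [w lw le] := H (k + count_mem a v)%N.
exists (u ++ wdiff w v); first by rewrite legal_cat lu uE -vE legal_wdiff.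
by rewrite count_cat count_wdiff; lia.
Qed.

(** Some [d] in the component has a legal word containing [wf], which [legal_extend] prolongs again
    and again by the letters of [wf]; [unbounded_transfer] passes from [d] to [c]. *)
Lemma expanding_unbounded c a k : ample (component_of c) -> a \in wf ->
  exists2 w, legal w c & (k <= count_mem a w)%N.
Proof.
move=> Ca awf; move: k.
have [d [w [dc dL lw le]]] := ample_locally_recurrent (size wf) Ca.
apply: (unbounded_transfer (esym dc)) => k.
suff [v lv] : exists2 v, legal v d & (forall b, count_mem b wf <= count_mem b v)%N
    /\ (k <= count_mem a v)%N by move=> [_ H]; exists v.
elim: k => [|k [v lv [lev kv]]].
  by exists w => //; split=> // b; apply: leq_trans (le b); apply: count_size.
have [u lu uE] := legal_extend dL lv lev; exists (v ++ u) => //.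
have : (0 < count_mem a wf)%N by rewrite -has_count has_pred1.
split=> [b|]; rewrite count_cat ?uE; last by lia.
exact: leq_trans (lev b) (leq_addr _ _).
Qed.

(** Omitting [R] copies of [wb] from a long legal word [w] stays in the component and yields
    [psi *+ R] more letters than [w] does. As [R] is the size of [wb], adding further copies of
    [psi] can be undone by executing [wb] legally. *)
Lemma contracting_representative (C : component N) : ample C ->
  exists z : config N, [/\ locally_recurrent z.2, forall a, a \in wb -> 0 <= z.1 a &
    forall k, component_of (z.1 + psi *+ k, z.2) = C].
Proof.
move=> Ca; pose R := size wb; pose u := flatten (nseq R wb).
(* The extra copy makes every letter occur in [w] even if [u] is empty, as [fired_ge0] requires. *)
have [c [w [cC cL lw le]]] := ample_locally_recurrent (size u + 1)%N Ca.
have lew a : (count_mem a u <= count_mem a w)%N.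
  by apply: leq_trans (le a); apply: leq_trans (count_size _ _) (leq_addr _ _).
have zL : locally_recurrent (piword w c).2.
  by rewrite piwordE; apply: locally_recurrent_tword.
have z0 a : 0 <= (piword w c).1 a.
  apply: fired_ge0 => //; rewrite -has_pred1 has_count; have := le a; lia.
have zC : component_of ((piword w c).1 + psi *+ R, (piword w c).2) = C.
  have vL : locally_recurrent (piword (wdiff w u) c).2.
    by rewrite piwordE; apply: locally_recurrent_tword.
  rewrite -cC -(component_removal (u := wdiff w u) lw); last first.
    by move=> a; rewrite count_wdiff leq_subr.
  congr component_of.
  have -> : piword w c = piword u (piword (wdiff w u) c).
    rewrite -piword_cat; apply: piword_perm; rewrite perm_sym perm_catC.
    exact: wdiff_perm.
  by rewrite (piword_flatten_nseq _ wbP) //= mulNrn subrK -surjective_pairing.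
exists ((piword w c).1 + psi *+ R, (piword w c).2); split=> // [a awb|k] /=.
  rewrite ffunE ffunMnE; apply: le_trans (le_add_mulrn R (z0 a) (psi_gt0 awb)).
  by [].
elim: k => [|k IH]; first by rewrite addr0.
rewrite -[RHS]IH; apply: component_reaches; exists wb; split; last first.
  by rewrite wbP //= mulrSr addrA addrK.
apply: legal_plenty => a awb; rewrite -addrA -mulrnDr /= ffunE ffunMnE.
apply: le_trans (le_add_mulrn _ (z0 a) (psi_gt0 awb)); rewrite lez_nat.
exact: leq_trans (count_size _ _) (leq_addr _ _).
Qed.

(** The representatives [z] and [z'] have a common image under [v] and [v']. After adding [psi *+ k]
    to both, the letters of [wb] can be fired [k] times at once and those of [wf] by
    [expanding_unbounded]; so [v] and [v'] keep the components, and these meet. *)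
Lemma ample_sim_eq (C C' : component N) c c' : ample C -> ample C' ->
  component_of c = C -> component_of c' = C' -> sim c c' -> C = C'.
Proof.
move=> Ca Ca' cC cC' s.
have [z [zL z0 zC]] := contracting_representative Ca.
have [z' [zL' z0' zC']] := contracting_representative Ca'.
have /sim_trans szz : sim z c.
  by apply: component_sim; rewrite cC -(zC 0) addr0 -surjective_pairing.
have szz' : sim c' z'.
  by apply: component_sim; rewrite cC' -(zC' 0) addr0 -surjective_pairing.
have {szz szz'}[v [v' E]] := sim_trans (szz _ s) szz'.
pose k := (size v + size v')%N.
have H (y : config N) u D : component_of (y.1 + psi *+ k, y.2) = D -> ample D ->
    (forall a, a \in wb -> 0 <= y.1 a) -> (size u <= k)%N ->
    component_of (piword u (y.1 + psi *+ k, y.2)) = D.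
  move=> yD Da y0 uk.
  have [a|w lw le] := @legal_joins _ k (y.1 + psi *+ k, y.2).
    have [awf|awb] := wfb a; first by apply: expanding_unbounded; rewrite ?yD.
    exists (nseq k a); last by rewrite count_nseq /= eqxx mul1n.
    apply: legal_plenty => b /nseqP[-> _]; rewrite count_nseq /= eqxx mul1n.
    by rewrite ffunE ffunMnE le_add_mulrn ?psi_gt0 ?y0.
  rewrite (component_removal lw) // => a.
  by apply: leq_trans (le a); apply: leq_trans uk; apply: count_size.
rewrite -(H z v C) //; last exact: leq_addr.
rewrite -(H z' v' C') //; last exact: leq_addl.
by rewrite !piword_shiftZ -!surjective_pairing E.
Qed.

End Drifting.

(** * Large configurations are recurrent *)

Section Walks.
Variable N : finite_abelian_network.
Implicit Types (a b : letter N) (u v w : seq (letter N)) (c d : config N).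

Lemma infinite_set_seq (A : set int) (f : nat -> int) :
  injective f -> (forall n, A (f n)) -> infinite_set A.
Proof.
move=> fI fA Afin; apply: infinite_nat.
have -> : setT = (f @^-1` A)%classic by apply/seteqP; split=> // n _; exact: fA.
by apply: finite_preimage => // m n _ _; apply: fI.
Qed.

Lemma divmodz (i j : int) (l r : nat) : (r < l)%N -> i = j * l%:Z + r%:Z ->
  (i %/ l%:Z)%Z = j /\ `|(i %% l%:Z)%Z|%N = r.
Proof.
move=> rl ->; rewrite divzMDl ?modzMDl; last by lia.
by rewrite divz_small ?modz_small ?addr0 //; lia.
Qed.

(** The walk is periodic: block [j], from index j * l to (j + 1) * l, executes [u] if j >= 0 and [v]
    if j < 0, starting at [e j]. Keeping [I] general lets the three index sets share the
    construction. *)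
Lemma two_sided_walk (I : set int) u v (alpha beta x : zvec N) q :
  (0 < size u)%N -> size u = size v ->
  (forall y, piword u (y, q) = (y + alpha, q)) ->
  (forall y, piword v (y, q) = (y - beta, q)) ->
  (forall i, 0 < i -> I i -> forall n, legal u (x + alpha *+ n, q)) ->
  (forall i, i < 0 -> I i -> forall n, legal v (x + beta *+ n, q)) ->
  (forall n : nat, I (n.+1)%:Z -> I n%:Z) ->
  (forall n : nat, I (- (n.+1)%:Z) -> I (- n%:Z)) ->
  (forall b, (b \in u /\ forall n : nat, I n%:Z) \/
             (b \in v /\ forall n : nat, I (- n%:Z))) ->
  has_diverse_walk I (component_of (x, q)).
Proof.
set l := size u => l0 lv uP vP Iu Iv Ipos Ineg cov.
have [a0 _] : exists a0, a0 \in u.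
  by move: l0; rewrite /l; case: (u) => // a s _; exists a; rewrite mem_head.
pose W (j : int) := if j is Posz _ then u else v.
pose e (j : int) : config N :=
  (x + match j with Posz n => alpha *+ n | Negz n => beta *+ n.+1 end, q).
have sW j : size (W j) = l by case: j.
have We j : piword (W j) (e j) = e (j + 1).
  case: j => [n|[|n]]; rewrite /e /=.
  - by rewrite uP addn1 mulrSr addrA.
  - by rewrite vP addrK addr0.
  by rewrite vP [beta *+ n.+2]mulrSr addrA addrK subn1.
pose c i := piword (take `|(i %% l%:Z)%Z|%N (W (i %/ l%:Z)%Z)) (e (i %/ l%:Z)%Z).
(* The letter at index [i] leads from [i - 1] to [i], hence the shift by one. *)
pose a i := nth a0 (W ((i - 1) %/ l%:Z)%Z) `|((i - 1) %% l%:Z)%Z|%N.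
have dm i : exists j (r : nat), (r < l)%N /\ i = j * l%:Z + r%:Z.
  exists (i %/ l%:Z)%Z, `|(i %% l%:Z)%Z|%N; split.
    by have := ltz_mod i (_ : l%:Z != 0); lia.
  by rewrite {1}(divz_eq i l%:Z) gez0_abs // modz_ge0 //; lia.
have cE (j : int) (r : nat) : (r <= l)%N ->
    c (j * l%:Z + r%:Z) = piword (take r (W j)) (e j).
  (* The end of block [j] is the start of block [j + 1]. *)
  rewrite leq_eqVlt => /predU1P[->|rl]; last first.
    by rewrite /c; have [-> ->] := divmodz rl (erefl (j * l%:Z + r%:Z)).
  rewrite /c; have [-> ->] : ((j * l%:Z + l%:Z) %/ l%:Z)%Z = j + 1 /\
    `|((j * l%:Z + l%:Z) %% l%:Z)%Z|%N = 0%N by apply: divmodz; lia.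
  by rewrite take0 -[in take l _](sW j) take_size We.
have step i : I (i - 1) -> I i -> legal_step (a i) (c (i - 1)) (c i).
  move=> Ii1 Ii; have [j [r [rl ij]]] := dm (i - 1).
  have -> : c i = piword (take r.+1 (W j)) (e j).
    by rewrite -cE //; congr c; lia.
  have -> : a i = nth a0 (W j) r by rewrite /a; have [-> ->] := divmodz rl ij.
  have -> : c (i - 1) = piword (take r (W j)) (e j) by rewrite ij cE // ltnW.
  have : legal (W j) (e j).
    case: j ij => n ij; first by apply: (Iu i) => //; lia.
    by apply: (Iv (i - 1)) => //; nia.
  rewrite -{1}(cat_take_drop r (W j)) legal_cat (drop_nth a0) ?sW //=.
  move=> /and3P[_ le _]; split=> //.
  by rewrite (take_nth a0) ?sW // -cats1 piword_cat.
have c0 : c 0 = (x, q).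
  by rewrite -[0]/(0 * l%:Z + 0%:Z) cE // take0 /= /e addr0.
have comp i : I (i - 1) -> I i -> component_of (c (i - 1)) = component_of (c i).
  move=> I1 I2; have [le ->] := step i I1 I2.
  by apply: component_reaches; exists [:: a i]; rewrite /= le.
exists c, a; split=> // [i Ii|b].
  rewrite -c0; case: i Ii => n; last first.
    rewrite NegzE; elim: n => [|n IH] In.
      by have := comp 0; rewrite sub0r => ->//; apply: (Ineg 0).
    have In1 := Ineg _ In; rewrite -(IH In1).
    have E : - (n.+2)%:Z = - (n.+1)%:Z - 1 by lia.
    by rewrite E comp // -E.
  elim: n => // n IH In; have In1 := Ipos _ In; rewrite -(IH In1).
  have E : n%:Z = (n.+1)%:Z - 1 by lia.
  by rewrite E comp // -E.
have aE (j : int) w : W j = w -> b \in w -> a (j * l%:Z + (index b w)%:Z + 1) = b.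
  move=> Wj bw; rewrite /a addrK.
  have bl : (index b w < l)%N by rewrite -(sW j) Wj index_mem.
  by have [-> ->] := divmodz bl (erefl (j * l%:Z + (index b w)%:Z)); rewrite Wj nth_index.
have [[bu In]|[bv In]] := cov b.
  apply: (@infinite_set_seq _ (fun n : nat => n%:Z * l%:Z + (index b u)%:Z + 1)).
    by move=> m n /addIr/addIr/mulIf E; have [] : m = n :> int by apply: E; lia.
  move=> n; split; last exact: aE.
    rewrite addrK; exact: (In (n * l + index b u)%N).
  rewrite -addrA; exact: (In (n * l + (index b u + 1))%N).
have bl : (index b v < l)%N by rewrite lv index_mem.
apply: (@infinite_set_seq _ (fun n : nat => Negz n * l%:Z + (index b v)%:Z + 1)).
  by move=> m n /addIr/addIr/mulIf E; have [] : Negz m = Negz n :> int by apply: E; lia.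
move=> n; split; last exact: aE.
  have -> : Negz n * l%:Z + (index b v)%:Z + 1 - 1 = - (n.+1 * l - index b v)%N%:Z by nia.
  exact: In.
have -> : Negz n * l%:Z + (index b v)%:Z + 1 = - (n.+1 * l - index b v - 1)%N%:Z by nia.
exact: In.
Qed.

End Walks.

Lemma exists_letter (N : finite_abelian_network) : exists a : letter N, true.
Proof.
have /card_gt0P[v _] := vertex_gt0 N; have /card_gt0P[a _] := alphabet_gt0 v.
by exists (to_letter a).
Qed.

Section LargeConfigurations.
Variable N : finite_abelian_network.
Variables (wf wb : seq (letter N)) (phi : nvec N) (psi : zvec N).
Hypothesis wfP : forall c : config N, locally_recurrent c.2 ->
  piword wf c = (c.1 + toZ phi, c.2).
Hypothesis wbP : forall c : config N, locally_recurrent c.2 ->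
  piword wb c = (c.1 - psi, c.2).
Hypothesis psi_gt0 : forall a, a \in wb -> 1 <= psi a.
Hypothesis wfb : forall a, a \in wf \/ a \in wb.

(** Repeating [wf] forward only gains letters, and undoing [wb] backward only gains letters of [wb],
    so a bound on the word sizes keeps every block legal. The exponents in [u] and [v] make their
    lengths equal. *)
Lemma large_recurrent : exists R : nat, forall (x : zvec N) q,
  locally_recurrent q -> (forall a, R%:Z <= x a) ->
  recurrent (component_of (x, q)).
Proof.
pose u := flatten (nseq (size wb) wf); pose v := flatten (nseq (size wf) wb).
pose R := (size wf + size wb + size u + size v)%N.
have [Rwf Rwb Ru Rv] : [/\ size wf <= R, size wb <= R, size u <= R & size v <= R]%N.
  by split; rewrite /R; lia.
exists R => x q qL xR.
have legalR w (y : zvec N) : (size w <= R)%N -> (forall a, a \in w -> x a <= y a) ->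
    legal w (y, q).
  move=> wR xy; apply: legal_plenty => a aw; apply: le_trans (xy a aw).
  apply: le_trans (xR a); rewrite lez_nat.
  exact: leq_trans (count_size _ _) wR.
have leN (y z : zvec N) n a : 0 <= z a -> y a <= (y + z *+ n) a.
  by move=> z0; rewrite !ffunE ffunMnE lerDl mulrn_wge0.
have phi0 n a : 0 <= (toZ phi *+ n) a by rewrite ffunMnE ffunE mulrn_wge0.
have psi0 n a : a \in wb -> 0 <= (psi *+ n) a.
  by move=> awb; rewrite ffunMnE mulrn_wge0 //; apply: le_trans (psi_gt0 awb).
have wfP1 y : piword wf (y, q) = (y + toZ phi, q) by rewrite wfP.
have wbP1 y : piword wb (y, q) = (y - psi, q) by rewrite wbP.
have [a0 _] := exists_letter N.
(* If one word is empty, the other contains every letter and a one-sided walk suffices; the word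
   given for the absent side is a filler. *)
have [wf0|wfN0] := posnP (size wf).
  have wbT b : b \in wb by have [|//] := wfb b; rewrite (size0nil wf0).
  apply: Or31; apply: (@two_sided_walk _ _ wb wb (- psi) psi) => //=.
  - by rewrite lt0n size_eq0; apply/eqP => E; have := wbT a0; rewrite E.
  - by move=> i i0 i0'; lia.
  - move=> i _ _ n; apply: legalR => [|a awb]; first by [].
    by apply: leN; apply: le_trans (psi_gt0 awb).
  - by move=> n; lia.
  - by move=> b; right; split=> // n; lia.
have [wb0|wbN0] := posnP (size wb).
  have wfT b : b \in wf by have [//|] := wfb b; rewrite (size0nil wb0).
  apply: Or32; apply: (@two_sided_walk _ _ wf wf (toZ phi) (- toZ phi)) => //=.
  - by move=> y; rewrite opprK.
  - move=> i _ _ n; apply: legalR => [|a awf]; first by [].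
    by apply: leN; rewrite ffunE.
  - by move=> i i0 i0'; lia.
  - by move=> b; left.
have v_mem a : a \in v = (a \in wb).
  by apply/flattenP/idP => [[w /nseqP[-> _]]|awb] //; exists wb => //; apply/nseqP.
have u_mem' a : a \in wf -> a \in u.
  by move=> awf; apply/flattenP; exists wf => //; apply/nseqP.
have size_rep k w : size (flatten (nseq k w)) = (k * size w)%N :> nat.
  by elim: k => //= k IH; rewrite size_cat IH mulSn.
apply: Or33.
apply: (@two_sided_walk _ _ u v (toZ phi *+ size wb) (psi *+ size wf)) => //=.
- by rewrite size_rep muln_gt0 wbN0 wfN0.
- by rewrite !size_rep mulnC.
- by move=> y; rewrite (piword_flatten_nseq _ wfP).
- by move=> y; rewrite (piword_flatten_nseq _ wbP) // mulNrn.
- move=> i _ _ n; apply: legalR => [|a _]; first by [].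
  exact: leN.
- move=> i _ _ n; apply: legalR => [|a av]; first by [].
  by apply: leN; apply: psi0; rewrite -v_mem.
by move=> b; have [/u_mem' bu|] := wfb b; [left | rewrite -v_mem; right].
Qed.

End LargeConfigurations.

(** * The shift monoid and its Grothendieck group *)

Section ShiftMonoid.
Variable N : finite_abelian_network.
Hypothesis Nirr : locally_irreducible N.
Implicit Types (C D : rec_component N) (n m : nvec N).

Lemma rec_ample C : ample (val C).
Proof. by apply/recurrent_ample/asboolP/(valP C). Qed.

Lemma rec_sim_eq C D c d : component_of c = val C -> component_of d = val D ->
  sim c d -> C = D.
Proof.
move=> cC dD cd; have [wf [wb [phi' [psi [wfP wbP psi0 wfb]]]]] := drift_words Nirr.
by apply: val_inj; apply: (ample_sim_eq wfP wbP psi0 wfb) cC dD cd; apply: rec_ample.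
Qed.

Lemma rec_representative C : exists (x : zvec N) q,
  locally_recurrent q /\ component_of (x, q) = val C.
Proof.
have [[x q] [w [cC qL _ _]]] := ample_locally_recurrent 0 (rec_ample C).
by exists x, q.
Qed.

Lemma val_phi n C x q : component_of (x, q) = val C ->
  component_of (x + toZ n, q) = val (phi n C).
Proof. by move=> xC; rewrite /= -xC shift_componentE. Qed.

Lemma phiC m n C : phi m (phi n C) = phi n (phi m C).
Proof. by rewrite -!phiD addrC. Qed.

(** Similarity is invariant under shifts by integer vectors, negative ones included, so the shift
    can be undone. *)
Lemma phi_inj n : injective (phi n).
Proof.
move=> C D E; have [x [q [qL xC]]] := rec_representative C.
have [y [r [rL yD]]] := rec_representative D.
apply: (rec_sim_eq xC yD).
rewrite -[x](addrK (toZ n)) -[y](addrK (toZ n)); apply: sim_shiftZ.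
by apply: component_sim; rewrite (val_phi n xC) (val_phi n yD) E.
Qed.

Lemma phi_eqP n m C : phi n C = phi m C <-> toZ n - toZ m \in @production_lattice N.
Proof.
have [x [q [qL xC]]] := rec_representative C.
rewrite -(production_latticeP Nirr n m x qL); split=> [E|].
  by apply: component_sim; rewrite !(val_phi _ xC) E.
exact: rec_sim_eq (val_phi n xC) (val_phi m xC).
Qed.

Lemma large_rec_component : exists R : nat, forall (x : zvec N) q,
  locally_recurrent q -> (forall a, R%:Z <= x a) ->
  exists C, val C = component_of (x, q).
Proof.
have [wf [wb [phi' [psi [wfP wbP psi0 wfb]]]]] := drift_words Nirr.
have [R RP] := large_recurrent wfP wbP psi0 wfb; exists R => x q qL xR.
by exists (exist _ (component_of (x, q)) (asboolT (RP x q qL xR))).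
Qed.

Lemma exists_rec_component : exists C : rec_component N, true.
Proof.
have [R RP] := large_rec_component; have [q qL] := exists_locally_recurrent N.
by have [|C _] := RP [ffun=> R%:Z] q qL; [move=> a; rewrite ffunE | exists C].
Qed.

Lemma shift_ofD m n : shift_of m + shift_of n = shift_of (m + n).
Proof. by apply: val_inj; apply/funext => C /=; rewrite phiD. Qed.

Lemma shift_of_eqP n m :
  shift_of n = shift_of m <-> toZ n - toZ m \in @production_lattice N.
Proof.
have [C _] := exists_rec_component.
split=> [/(congr1 val)/(congr1 (@^~ C))/= /phi_eqP //|H].
by apply: val_inj; apply/funext => D /=; apply/phi_eqP.
Qed.

Lemma groth_shiftP n n' m m' :
  groth_pair (shift_of n) (shift_of n') = groth_pair (shift_of m) (shift_of m') <->
  (toZ n - toZ n') - (toZ m - toZ m') \in @production_lattice N.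
Proof.
have E s : toZ (s + n + m') - toZ (s + n' + m) = (toZ n - toZ n') - (toZ m - toZ m').
  by rewrite !toZD; apply/ffunP=> a; rewrite !ffunE; ring.
rewrite groth_pairP; split=> [[s]|H].
  have /asboolP[k sk] := valP s; have -> : s = shift_of k by apply: val_inj.
  by rewrite !shift_ofD => /shift_of_eqP; rewrite E.
by exists (shift_of 0); rewrite !shift_ofD; apply/shift_of_eqP; rewrite E.
Qed.

Lemma shift_groupP (g : shift_group N) :
  exists n n', g = groth_pair (shift_of n) (shift_of n').
Proof.
elim/groth_ind: g => m m'.
have /asboolP[n nE] := valP m; have /asboolP[n' nE'] := valP m'.
by exists n, n'; congr groth_pair; apply: val_inj.
Qed.

(** By injectivity of [phi], the condition for one pair representing [g] implies it for all of
    them. *)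
Lemma translateI (g : tor N) C D n n' :
  val g = groth_pair (shift_of n) (shift_of n') ->
  phi n C = phi n' D -> translate g C D.
Proof.
move=> gE nE m m'; rewrite gE => /groth_shiftP H; apply: (@phi_inj n').
rewrite phiC [RHS]phiC -nE -!phiD; apply/phi_eqP.
suff -> : toZ (m + n') - toZ (m' + n) = - (toZ n - toZ n' - (toZ m - toZ m')).
  by rewrite rpredN.
by rewrite !toZD; apply/ffunP=> a; rewrite !ffunE; ring.
Qed.

Lemma translate_unique (g : tor N) C D D' :
  translate g C D -> translate g C D' -> D = D'.
Proof.
move=> H H'; have [n [n' E]] := shift_groupP (val g).
by apply: (@phi_inj n'); rewrite -(H _ _ E) (H' _ _ E).
Qed.

Lemma translate0 C : translate 0 C C.
Proof. exact: (@translateI _ _ _ 0 0). Qed.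

Lemma translateD (g h : tor N) C D E :
  translate h C D -> translate (g + h) C E <-> translate g D E.
Proof.
move=> hCD; have [n [n' nE]] := shift_groupP (val g).
have [m [m' mE]] := shift_groupP (val h).
have gh : val (g + h) = groth_pair (shift_of (n + m)) (shift_of (n' + m')).
  by rewrite -!shift_ofD -groth_addE -nE -mE.
have mCD := hCD _ _ mE.
split=> [/(_ _ _ gh)|/(_ _ _ nE)] H.
  by apply: (translateI nE); apply: (@phi_inj m'); rewrite phiC -mCD -phiD H phiD phiC.
by apply: (translateI gh); rewrite phiD mCD phiC H -phiD addrC.
Qed.

End ShiftMonoid.

(** * Finiteness of the torsion group *)

Lemma groth_pairMn (M : nmodType) (m m' : M) k :
  groth_pair m m' *+ k = groth_pair (m *+ k) (m' *+ k).
Proof. by elim: k => // k IH; rewrite !mulrS IH [LHS]groth_addE. Qed.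

Lemma shift_ofMn (N : finite_abelian_network) (n : nvec N) k :
  shift_of n *+ k = shift_of (n *+ k).
Proof. by elim: k => // k IH; rewrite !mulrS IH shift_ofD. Qed.

Section Torsion.
Variable N : finite_abelian_network.
Hypothesis Nirr : locally_irreducible N.
Local Notation P := (production_matrix N).

(** Integrality holds because Pk is the difference of the message counts of the two parts of [k]. *)
Lemma production_lattice_image (k : zvec N) : k \in @total_kernel N ->
  exists2 y : zvec N, y \in @production_lattice N &
    forall a, (y a)%:~R = (k a)%:~R - Defs.mulA P k a.
Proof.
move=> kK; have [q qL] := exists_locally_recurrent N.
have tE : tword (word_of (posv k)) q = tword (word_of (negv k)) q.
  by move/asboolP: kK; apply.
pose y := k - toZ (mword (word_of (posv k)) q) + toZ (mword (word_of (negv k)) q).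
suff yE a : (y a)%:~R = (k a)%:~R - Defs.mulA P k a.
  by exists y => //; apply/asboolP; exists k.
have := mulA_production Nirr a qL tE; rewrite !occ_word_of posvB_negv => ->.
by rewrite !ffunE rmorphD rmorphB /= -!pmulrn opprB addrA addrAC.
Qed.

Lemma multiple_total_kernel : exists2 m, (0 < m)%N &
  forall z : zvec N, z *+ m \in @total_kernel N.
Proof.
have [m [G [m0 GP]]] := multiple_loops Nirr; exists m => // z.
have H (n : nvec N) : toZ (n *+ m) \in @total_kernel N.
  by have [/loop_total_kernel] := GP n; rewrite occ_word_of.
have -> : z *+ m = toZ (posv z *+ m) - toZ (negv z *+ m); last exact: rpredB.
rewrite -{1}(posvB_negv z) mulrnBl; congr (_ - _).
  by apply/ffunP=> a; rewrite ffunMnE !ffunE nvec_mulrnE PoszM -mulr_natr natz ffunE.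
by apply/ffunP=> a; rewrite ffunMnE !ffunE nvec_mulrnE PoszM -mulr_natr natz !ffunE.
Qed.

(** Let k y = (I - P) kap and divide [kap] by k m with remainder [rho]. The multiple of k m
    contributes k times an element [l] of the lattice, so k (y - l) = (I - P) rho. The entries of
    [rho] are below k m, and dividing by [k] leaves a bound independent of [y] and [k]. *)
Lemma bounded_torsion : exists B : nat, forall (y : zvec N) (k : nat), (0 < k)%N ->
  y *+ k \in @production_lattice N ->
  exists2 y' : zvec N, y - y' \in @production_lattice N & forall a, (`|y' a| <= B)%N.
Proof.
have [m m0 mK] := multiple_total_kernel.
pose r a : rat := m%:R * (1 + \sum_b `|P (a, b)|).
have r0 a : 0 <= r a.
  by rewrite mulr_ge0 // addr_ge0 // sumr_ge0.
exists (\max_a Num.bound (r a))%N => y k k0 /asboolP[kap kapK kapE].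
pose s : zvec N := [ffun a => (kap a %/ (k * m)%N%:Z)%Z].
pose rho := kap - s *+ m *+ k.
have rhoE a : rho a = (kap a %% (k * m)%N%:Z)%Z.
  rewrite /rho !ffunE !ffunMnE ffunE -mulrnA mulnC -mulr_natr natz.
  by rewrite {1}(divz_eq (kap a) (m * k)%N%:Z) addrAC subrr add0r.
have rho0 a : 0 <= rho a by rewrite rhoE modz_ge0 //; lia.
have rho_lt a : rho a < (k * m)%N%:Z by rewrite rhoE ltz_pmod //; lia.
have [l lL lE] := production_lattice_image (mK s).
exists (y - l) => [|a]; first by rewrite opprB addrC subrK.
have mulAMn (z : zvec N) j : Defs.mulA P (z *+ j) a = Defs.mulA P z a *+ j.
  rewrite !ffunE -sumrMnl; apply: eq_bigr => b _.
  by rewrite ffunMnE rmorphMn /= mulrnAr.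
have E : ((y - l) a)%:~R *+ k = (rho a)%:~R - Defs.mulA P rho a.
  have ya := kapE a; rewrite ffunMnE rmorphMn /= in ya.
  rewrite mulAB mulAMn.
  have -> : (y - l) a = y a - l a by rewrite !ffunE.
  have -> : rho a = kap a - (s *+ m) a *+ k by rewrite !ffunE ffunMnE.
  rewrite !rmorphB /= rmorphMn /= mulrnBl ya lE mulrnBl.
  by rewrite opprB !opprD !opprK !addrA; ring.
have le : `|((y - l) a)%:~R| <= r a.
  have kr : (0 : rat) < k%:R by rewrite ltr0n.
  rewrite -(ler_pM2r kr) -[X in _ * X]gtr0_norm // -normrM mulr_natr E.
  have rhoR b : `|(rho b)%:~R| <= k%:R * m%:R :> rat.
    by rewrite ger0_norm ?ler0z // -natrM [X in _ <= X]pmulrn ler_int ltW.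
  apply: le_trans (ler_normB _ _) _; rewrite /r mulrAC [m%:R * _]mulrC mulrDr mulr1.
  rewrite lerD // ffunE mulr_sumr; apply: le_trans (ler_norm_sum _ _ _) _.
  by apply: ler_sum => b _; rewrite normrM [X in _ <= X]mulrC ler_wpM2l.
apply: leq_trans (leq_bigmax (F := fun a => Num.bound (r a)) a).
rewrite -(ler_nat rat) natr_absz intr_norm; apply: le_trans le _.
exact/ltW/archi_boundP.
Qed.

Lemma finite_tor : finite_set [set: tor N]%classic.
Proof.
have [B BP] := bounded_torsion.
(* These are the vectors with entries between -B and B; by [bounded_torsion] their classes include
   all torsion elements. *)
pose y_of (t : {ffun letter N -> 'I_(B + B).+1}) : zvec N := [ffun a => (t a)%:Z - B%:Z].
pose h t := groth_pair (shift_of (posv (y_of t))) (shift_of (negv (y_of t))).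
have -> : [set: tor N]%classic = ((fun g : tor N => val g) @^-1` range h)%classic.
  apply/seteqP; split=> // g _ /=.
  have [n [n' gE]] := shift_groupP (val g).
  have /asboolP[k k0 gk] := valP g.
  have [y' yy' y'B] : exists2 y', (toZ n - toZ n') - y' \in @production_lattice N &
      forall a, (`|y' a| <= B)%N.
    apply: (BP _ k k0).
    have toZMn (p : nvec N) : toZ (p *+ k) = toZ p *+ k.
      elim: (k) => [|j IH]; first by apply/ffunP=> a; rewrite !ffunE.
      by rewrite !mulrS toZD IH.
    have : groth_pair (shift_of (n *+ k)) (shift_of (n' *+ k))
        = groth_pair (shift_of 0) (shift_of 0).
      by rewrite -!shift_ofMn -groth_pairMn -gE gk.
    by move=> /(groth_shiftP Nirr); rewrite !subrr subr0 !toZMn mulrnBl.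
  exists [ffun a => inord (absz (y' a + B%:Z)%R)] => //.
  have yE : y_of [ffun a => inord (absz (y' a + B%:Z)%R)] = y'.
    by apply/ffunP=> a; rewrite !ffunE inordK; have := y'B a; lia.
  rewrite gE /h yE; apply/esym/(groth_shiftP Nirr); rewrite (posvB_negv y').
  by [].
apply: finite_preimage; first by move=> g1 g2 _ _; apply: val_inj.
by apply: finite_image; apply: finite_finset.
Qed.

End Torsion.

(** * Invertible components and the isomorphism *)

Section Main.
Variable N : finite_abelian_network.
Hypothesis Nirr : locally_irreducible N.

(** The torsion elements are finitely many, so a configuration exceeding the bound [R] by a large
    enough [D] stays above [R] when translated by any of them. *)
Lemma exists_invertible : exists C : rec_component N, invertible C.
Proof.
have /finite_seqP[s sE] := finite_tor Nirr.
have H (g : tor N) : exists nn : nvec N * nvec N,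
    val g = groth_pair (shift_of nn.1) (shift_of nn.2).
  by have [n [n' E]] := shift_groupP (val g); exists (n, n').
have [rep repE] := choice H.
have [R RP] := large_rec_component Nirr.
have [q qL] := exists_locally_recurrent N.
pose D := (\sum_(g <- s) \sum_a (rep g).2 a)%N.
have DP g a : ((rep g).2 a <= D)%N.
  have gs : g \in s by have : [set: tor N]%classic g by []; rewrite sE.
  rewrite /D (big_rem g) //= (bigD1 a) //=; lia.
pose x : zvec N := [ffun=> (R + D)%N%:Z].
have [a|C CE] := RP x q qL; first by rewrite ffunE; lia.
exists C => g.
have [a|C' CE'] := RP (x + toZ (rep g).1 - toZ (rep g).2) q qL.
  by rewrite !ffunE; have := DP g a; lia.
exists C'; apply: (translateI Nirr (repE g)); apply: val_inj.
by rewrite -(val_phi _ (esym CE)) -(val_phi _ (esym CE')) subrK.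
Qed.

Lemma torsion_action : exists act : tor N -> inv_component N -> inv_component N,
  (forall g C, unique (translate g (val C)) (val (act g C))) /\
  is_action act /\ free_action act.
Proof.
have H (gC : tor N * inv_component N) :
    exists C' : inv_component N, translate gC.1 (val gC.2) (val C').
  case: gC => g C; have /asboolP Cinv := valP C; have [D CD] := Cinv g.
  (* The translate of [D] by [h] is that of [C] by [h + g], which exists. *)
  suff Dinv : invertible D by exists (exist _ D (asboolT Dinv)).
  move=> h; have [E CE] := Cinv (h + g).
  by exists E; apply/(translateD Nirr h E CD).
have [act actP] := choice H; exists (fun g C => act (g, C)); split=> [g C|].
  split=> [|D]; first exact: (actP (g, C)).
  by apply: (translate_unique Nirr); exact: (actP (g, C)).
split; first split=> [C|g h C]; try apply: val_inj.
- by apply: (translate_unique Nirr (actP (0, C))); apply: translate0.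
- apply: (translate_unique Nirr (actP (g + h, C))).
  by apply/(translateD Nirr g _ (actP (h, C))); apply: (actP (g, _)).
move=> g h C E; apply: val_inj.
have [n [n' nE]] := shift_groupP (val g); have [m [m' mE]] := shift_groupP (val h).
have nC := actP (g, C) _ _ nE; have mC := actP (h, C) _ _ mE.
rewrite /= E in nC; rewrite nE mE; apply/(groth_shiftP Nirr).
(* Freeness: the cross-multiplied shifts agree on [C], and by [phi_eqP] agreement on one component
   identifies [g] and [h]. *)
have /(phi_eqP Nirr) : phi (n + m') (val C) = phi (n' + m) (val C).
  by rewrite addrC !phiD nC mC phiC.
suff -> : toZ (n + m') - toZ (n' + m) = toZ n - toZ n' - (toZ m - toZ m') by [].
by rewrite !toZD; apply/ffunP=> a; rewrite !ffunE; ring.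
Qed.

(** [groth_shiftP] makes the map well defined and injective at once; it is onto because an integer
    vector is the difference of its positive and negative parts. *)
Lemma shift_group_iso :
  exists f : {additive shift_group N -> zquot (@production_lattice N)},
    bijective f /\ forall n n' : nvec N,
      f (groth_pair (shift_of n) (shift_of n'))
      = zquot_pi (@production_lattice N) (toZ n - toZ n').
Proof.
have H (g : shift_group N) : exists nn : nvec N * nvec N,
    g = groth_pair (shift_of nn.1) (shift_of nn.2).
  by have [n [n' E]] := shift_groupP g; exists (n, n').
have [rep repE] := choice H.
pose f (g : shift_group N) : zquot (@production_lattice N) :=
  zquot_pi (@production_lattice N) (toZ (rep g).1 - toZ (rep g).2).
have fE n n' : f (groth_pair (shift_of n) (shift_of n'))
    = zquot_pi (@production_lattice N) (toZ n - toZ n').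
  by apply/zquotP/(groth_shiftP Nirr); rewrite -repE.
have fB : zmod_morphism f.
  move=> g h; have [n [n' ->]] := shift_groupP g; have [m [m' ->]] := shift_groupP h.
  have -> : groth_pair (shift_of n) (shift_of n') - groth_pair (shift_of m) (shift_of m')
      = groth_pair (shift_of (n + m')) (shift_of (n' + m)).
    by rewrite [- _]groth_oppE [LHS]groth_addE !shift_ofD.
  rewrite !fE -[RHS]/(zquot_add _ (zquot_opp _)) zquot_oppE zquot_addE; congr zquot_pi.
  by rewrite !toZD; apply/ffunP=> a; rewrite !ffunE; ring.
pose fa : {additive shift_group N -> zquot (@production_lattice N)} :=
  HB.pack f (GRing.isZmodMorphism.Build _ _ f fB).
have zK y : zquot_pi (@production_lattice N) (repr y) = y by exact: reprK.
exists fa; split=> //.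
exists (fun y => groth_pair (shift_of (posv (repr y))) (shift_of (negv (repr y))))
  => [g|y].
  have [n [n' ->]] := shift_groupP g.
  apply/(groth_shiftP Nirr); rewrite posvB_negv; apply/zquotP.
  by rewrite zK -fE.
by rewrite [LHS]fE posvB_negv zK.
Qed.

End Main.

Theorem theorem4p21 (N : finite_abelian_network)
    (Nirr : locally_irreducible N) :
  (* (i) *)
  (exists C : rec_component N, invertible C) /\
  (* (ii) *)
  (finite_set [set: tor N]%classic /\
   exists act : tor N -> inv_component N -> inv_component N,
     (forall g C, unique (translate g (val C)) (val (act g C))) /\
     is_action act /\ free_action act) /\
  (* (iii) *)
  (exists f : {additive shift_group N -> zquot (@production_lattice N)},
     bijective f /\
     forall n n' : nvec N,
       f (groth_pair (shift_of n) (shift_of n'))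
       = zquot_pi (@production_lattice N) (toZ n - toZ n')).
Proof.
split; first exact: exists_invertible; split; last exact: shift_group_iso.
by split; [exact: finite_tor | exact: torsion_action].
Qed.
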